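(* Let $n\ge1$ and $\alpha\in(0,1)$. If $f\in BV^\alpha(\mathbb R^n)$, then there exists a sequence $(f_k)_{k\in\mathbb N}\subset C^\infty_c(\mathbb R^n)$ such that, as $k\to+\infty$, (i) $f_k\to f$ in $L^1(\mathbb R^n)$; (ii) $|D^\alpha f_k|(\mathbb R^n)\to|D^\alpha f|(\mathbb R^n)$.
   Context: For $\alpha\in(0,1)$ let $\mu_{n,\alpha}:=2^\alpha\pi^{-n/2}\,\Gamma\big(\tfrac{n+\alpha+1}{2}\big)/\Gamma\big(\tfrac{1-\alpha}{2}\big)$. For $\varphi\in C^\infty_c(\mathbb R^n;\mathbb R^n)$ the fractional $\alpha$-divergence is $$\mathrm{div}^\alpha\varphi(x):=\mu_{n,\alpha}\int_{\mathbb R^n}\frac{(y-x)\cdot(\varphi(y)-\varphi(x))}{|y-x|^{n+\alpha+1}}\,dy,$$ which is a function in $L^1(\mathbb R^n)\cap L^\infty(\mathbb R^n)$. For $f\in L^1(\mathbb R^n)$ the fractional variation is $$|D^\alpha f|(\mathbb R^n):=\sup\Big\{\int_{\mathbb R^n}f\,\mathrm{div}^\alpha\varphi\,dx:\ \varphi\in C^\infty_c(\mathbb R^n;\mathbb R^n),\ \|\varphi\|_{L^\infty(\mathbb R^n;\mathbb R^n)}\le1\Big\}.$$ The space $BV^\alpha(\mathbb R^n)$ consists of all $f\in L^1(\mathbb R^n)$ with $|D^\alpha f|(\mathbb R^n)<+\infty$. *)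

(* Defs.v *)
From HB Require Import structures.
From mathcomp Require Import all_boot all_order all_algebra.
From mathcomp Require Import all_classical all_reals all_analysis.

Set Implicit Arguments.
Unset Strict Implicit.
Unset Printing Implicit Defensive.

Import Order.TTheory GRing.Theory Num.Theory.
Import numFieldNormedType.Exports.

Local Open Scope classical_set_scope.
Local Open Scope ring_scope.

(* R^n is 'rV[R]_n; its Borel sigma-algebra is given as the product one,
   generated by the coordinate functions. *)
Section measurable_rV.
Context {R : realType} {n : nat}.

Definition coord_rV (i : 'I_n) (v : 'rV[R]_n) : R := v ord0 i.

Let rV_set0 : g_sigma_preimage coord_rV set0.
Proof. exact: sigma_algebra0. Qed.

Let rV_setC A : g_sigma_preimage coord_rV A -> g_sigma_preimage coord_rV (~` A).
Proof. exact: sigma_algebraC. Qed.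

Let rV_bigcup (F : _^nat) : (forall i, g_sigma_preimage coord_rV (F i)) ->
  g_sigma_preimage coord_rV (\bigcup_i (F i)).
Proof. exact: sigma_algebra_bigcup. Qed.

HB.instance Definition _ := @isMeasurable.Build default_measure_display
  'rV[R]_n (g_sigma_preimage coord_rV) rV_set0 rV_setC rV_bigcup.

Lemma measurable_coord_rV (i : 'I_n) : measurable_fun setT (coord_rV i).
Proof.
move=> _ Y mY; rewrite setTI; apply: sub_sigma_algebra => /=.
rewrite -bigcup_seq/=; exists i => /=; first by rewrite mem_index_enum.
by exists Y => //; rewrite setTI.
Qed.

Lemma measurable_fun_rVP d (T : measurableType d) (f : T -> 'rV[R]_n) :
  measurable_fun setT f <->
  forall i, measurable_fun setT (fun x => f x ord0 i).
Proof.
split=> [mf i|mf].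
  exact: (measurableT_comp (measurable_coord_rV i) mf).
apply: (measurability
  (\big[setU/set0]_(i < n) preimage_set_system setT (coord_rV i) measurable)).
  by [].
move=> _ [B + <-].
rewrite -bigcup_seq/= => -[i _] [A mA <-].
by rewrite setTI; exact: mf.
Qed.

End measurable_rV.

Section lebesgue_rV.
Context {R : realType}.

Definition cons_rV n (p : measurableTypeR R * 'rV[R]_n) : 'rV[R]_n.+1 :=
  row_mx (p.1)%:M p.2.

Definition uncons_rV n (v : 'rV[R]_n.+1) : measurableTypeR R * 'rV[R]_n :=
  (v ord0 ord0, @rsubmx R 1 1 n v).

Lemma cons_rV0 n p : @cons_rV n p ord0 ord0 = p.1.
Proof.
have -> : ord0 = lshift n (ord0 : 'I_1) by exact/val_inj.
by rewrite /cons_rV (@row_mxEl R 1 1 n) !mxE eqxx.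
Qed.

Lemma cons_rVS n p (i : 'I_n) : @cons_rV n p ord0 (lift ord0 i) = p.2 ord0 i.
Proof.
have -> : lift ord0 i = rshift 1 i by exact/val_inj.
by rewrite /cons_rV (@row_mxEr R 1 1 n).
Qed.

Lemma cons_rVK n : cancel (@cons_rV n) (@uncons_rV n).
Proof.
move=> p; rewrite /uncons_rV cons_rV0.
by rewrite /cons_rV (@row_mxKr R 1 1 n); case: p.
Qed.

Lemma uncons_rVK n : cancel (@uncons_rV n) (@cons_rV n).
Proof.
move=> v; apply/rowP => i; case: (unliftP ord0 i) => [j ->|->].
  rewrite cons_rVS mxE; congr (v _ _); exact/val_inj.
by rewrite cons_rV0.
Qed.

Lemma measurable_cons_rV n : measurable_fun setT (@cons_rV n).
Proof.
apply/measurable_fun_rVP => i; case: (unliftP ord0 i) => [j ->|->].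
  under eq_fun do rewrite cons_rVS.
  exact: (measurableT_comp (measurable_coord_rV j) measurable_snd).
under eq_fun do rewrite cons_rV0.
exact: measurable_fst.
Qed.

Lemma measurable_uncons_rV n : measurable_fun setT (@uncons_rV n).
Proof.
apply: measurable_fun_pair; first exact: (measurable_coord_rV ord0).
apply/measurable_fun_rVP => i.
under eq_fun do rewrite mxE.
exact: (measurable_coord_rV (rshift 1 i)).
Qed.

(* the image of a product measure under R * R^n ~= R^(n+1) *)
Section step.
Variables (n : nat) (mu : {sigma_finite_measure set 'rV[R]_n -> \bar R}).

Definition lebesgue_rV_step : set 'rV[R]_n.+1 -> \bar R :=
  pushforward (@lebesgue_measure R \x mu)%E (@cons_rV n).

Let step0 : lebesgue_rV_step set0 = 0%E.
Proof. by rewrite /lebesgue_rV_step /pushforward preimage_set0 measure0. Qed.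

Let step_ge0 A : (0 <= lebesgue_rV_step A)%E.
Proof. exact: (measure_ge0 (@lebesgue_measure R \x mu)%E). Qed.

Let step_sigma_additive : semi_sigma_additive lebesgue_rV_step.
Proof.
have mc := @measurable_cons_rV n.
move=> F mF tF mUF; rewrite /lebesgue_rV_step /pushforward preimage_bigcup.
apply: measure_semi_sigma_additive.
- by move=> k; rewrite -[X in measurable X]setTI; exact: mc.
- apply/trivIsetP => /= i j _ _ ij; rewrite -preimage_setI.
  by move/trivIsetP : tF => /(_ _ _ _ _ ij) ->//; rewrite preimage_set0.
- by rewrite -preimage_bigcup -[X in measurable X]setTI; exact: mc.
Qed.

HB.instance Definition _ := isMeasure.Build _ _ _
  lebesgue_rV_step step0 step_ge0 step_sigma_additive.

Let step_sigma_finite : sigma_finite setT lebesgue_rV_step.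
Proof.
have /sigma_finiteP[F [TF ndF Foo]] := sigma_finiteT (@lebesgue_measure R).
have /sigma_finiteP[G [TG ndG Goo]] := sigma_finiteT mu.
exists (fun k => @uncons_rV n @^-1` (F k `*` G k)).
  rewrite -preimage_bigcup (_ : \bigcup_k _ = setT) ?preimage_setT//.
  rewrite -setXTT TF TG predeqE => -[x y]; split.
    by move=> [k _ []/= ? ?]; split; exists k.
  move=> [/= [k _ Fkx] [l _ Gly]]; exists (maxn k l) => //; split.
  - by move: x Fkx; exact/subsetPset/ndF/leq_maxl.
  - by move: y Gly; exact/subsetPset/ndG/leq_maxr.
move=> k; have [mFk Fkoo] := Foo k; have [mGk Gkoo] := Goo k; split.
  rewrite -[X in measurable X]setTI; apply: measurable_uncons_rV => //.
  exact: measurableX.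
rewrite /lebesgue_rV_step /pushforward -comp_preimage.
rewrite (_ : _ \o _ = id) ?preimage_id; last first.
  by apply/funext => p /=; rewrite cons_rVK.
by rewrite product_measure1E// lte_mul_pinfty// ge0_fin_numE.
Qed.

HB.instance Definition _ := Measure_isSigmaFinite.Build _ _ _
  lebesgue_rV_step step_sigma_finite.

End step.

Fixpoint lebesgue_rV (n : nat) : {sigma_finite_measure set 'rV[R]_n -> \bar R} :=
  if n is m.+1 then lebesgue_rV_step (lebesgue_rV m) else \d_(0 : 'rV[R]_0).

Lemma lebesgue_rV_box n (A : 'I_n -> set R) : (forall i, measurable (A i)) ->
  lebesgue_rV n [set v | forall i, A i (v ord0 i)] =
  (\prod_(i < n) lebesgue_measure (A i))%E.
Proof.
elim: n A => [|n IHn] A mA.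
  rewrite big_ord0 /= diracE mem_set//; by case.
have mA' : measurable [set v : 'rV[R]_n | forall i, A (lift ord0 i) (v ord0 i)].
  rewrite (_ : mkset _ = \bigcap_(i in [set: 'I_n])
      (coord_rV i @^-1` A (lift ord0 i))).
    apply: fin_bigcap_measurable => // i _.
    by rewrite -[X in measurable X]setTI; exact: measurable_coord_rV.
  by apply/seteqP; split => v /= h i; [move=> _; exact: h|exact: h].
rewrite big_ord_recl -IHn// -product_measure1E//; last exact: (mA ord0).
congr (product_measure1 _ _ _); apply/seteqP; split => [p /= h|p [/= h0 h] i].
  split => [|i]; first by have := h ord0; rewrite cons_rV0.
  by have := h (lift ord0 i); rewrite cons_rVS.
case: (unliftP ord0 i) => [j ->|->]; first by rewrite cons_rVS; exact: h.
by rewrite cons_rV0.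
Qed.

End lebesgue_rV.
Arguments lebesgue_rV : clear implicits.

Section euclidean.
Context {R : realType} {n : nat}.

Definition dotrV (u v : 'rV[R]_n) : R := \sum_(i < n) u ord0 i * v ord0 i.

(* The norm `|_| that the library puts on 'rV[R]_n is the sup norm. *)
Definition enorm (v : 'rV[R]_n) : R := Num.sqrt (dotrV v v).

End euclidean.

Section smooth.
Context {R : realType} {n : nat} {W : normedModType R}.

Definition partial (i : 'I_n) (f : 'rV[R]_n -> W) : 'rV[R]_n -> W :=
  fun x => 'D_(delta_mx ord0 i) f x.

Definition iter_partial (s : seq 'I_n) (f : 'rV[R]_n -> W) : 'rV[R]_n -> W :=
  foldr partial f s.

Definition smooth (f : 'rV[R]_n -> W) : Prop :=
  forall s : seq 'I_n, continuous (iter_partial s f) /\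
    forall (i : 'I_n) x, derivable (iter_partial s f) x (delta_mx ord0 i).

Definition test_function (f : 'rV[R]_n -> W) : Prop :=
  smooth f /\ compact (closure [set x | f x != 0]).

End smooth.

Definition Gamma_fun {R : realType} (s : R) : R :=
  \int[@lebesgue_measure R]_(t in `]0, +oo[) (t `^ (s - 1) * expR (- t)).

Section fractional_variation.
Context {R : realType} (n : nat) (alpha : R).

Definition mu_const : R :=
  2 `^ alpha * pi `^ (- (n%:R / 2))
  * Gamma_fun ((n%:R + alpha + 1) / 2) / Gamma_fun ((1 - alpha) / 2).

(* At y = x the integrand is 0 / 0 = 0. *)
Definition frac_div (phi : 'rV[R]_n -> 'rV[R]_n) (x : 'rV[R]_n) : R :=
  mu_const * \int[lebesgue_rV R n]_y
    (dotrV (y - x) (phi y - phi x) / enorm (y - x) `^ (n%:R + alpha + 1)).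

Definition unit_test_field (phi : 'rV[R]_n -> 'rV[R]_n) : Prop :=
  test_function phi /\
  ('N[lebesgue_rV R n]_+oo[EFin \o (enorm \o phi)] <= 1)%E.

Definition frac_variation (f : 'rV[R]_n -> R) : \bar R :=
  ereal_sup [set (\int[lebesgue_rV R n]_x (f x * frac_div phi x)%:E)%E |
    phi in unit_test_field].

Definition BV_frac (f : 'rV[R]_n -> R) : Prop :=
  (lebesgue_rV R n).-integrable setT (EFin \o f) /\
  (frac_variation f < +oo)%E.

End fractional_variation.

(* Main.v *)
(** Let [eta_k] be a smooth cutoff, equal to 1 at 0, with values in [0, 1],
    supported in a cube of side of order [k] and Lipschitz with constant [L/k];
    put [g_k = eta_k f] and let [f_k] be a mollification of [g_k] at a scale
    such that [||f_k - g_k||_1 <= 1/k].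

    - Since [eta_k div^a phi - div^a (eta_k phi)] at [x] is
      [mu_{n,a} \int (y-x).phi(y) (eta_k(x) - eta_k(y)) / |y-x|^(n+a+1) dy], it is
      bounded by a constant [c_k -> 0], whence
      [|D^a g_k| <= |D^a f| + c_k ||f||_1].
    - Mollification is an average of translations and [div^a] commutes with
      translations, so Fubini gives [|D^a f_k| <= |D^a g_k|].
    - Each [div^a phi] is bounded, so [|D^a .|] is lower semicontinuous in [L^1].

    Hence [|D^a f_k|] is squeezed to [|D^a f|]. *)

Require Import Defs.
From HB Require Import structures.
From mathcomp Require Import all_boot all_order all_algebra.
From mathcomp Require Import all_classical all_reals all_analysis.
From mathcomp Require Import measurable_realfun ess_sup_inf.
From mathcomp Require Import ring lra.

Set Implicit Arguments.
Unset Strict Implicit.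
Unset Printing Implicit Defensive.

Import Order.TTheory GRing.Theory Num.Theory.
Import numFieldNormedType.Exports.

Local Open Scope classical_set_scope.
Local Open Scope ring_scope.

(** * Borel sets and Lebesgue measure *)

(** The estimates on [frac_div] rest on one function, h |-> min(1, s|h|) / |h|^(n+alpha)
    ([frac_kernel]). It behaves like |h|^(1-n-alpha) near 0 and like |h|^(-n-alpha) at infinity,
    hence is integrable for 0 < alpha < 1, and its integral tends to 0 with s. The constant c_k is a
    multiple of that integral for s proportional to 1/k. The commutator contains phi(y) and no
    increment of phi: all the regularity is taken from eta_k, so the bound is uniform over
    admissible fields, as a supremum requires. Cutting off comes before mollifying because the
    mollification inherits its compact support from g_k. Its scale depends on k and comes from the
    continuity of translations in L^1, proved here from the open sets upwards. Smoothness concerns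
    all iterated partial derivatives at once; each proof of it exhibits a class of continuous
    functions stable under partial derivatives. Sizes are measured in the sup norm, whose balls are
    cubes of explicit volume; the Euclidean norm of the definitions enters only through comparison
    with it. *)

Section rV_borel.
Context {R : realType} {n : nat}.
Implicit Types (u v x y : 'rV[R]_n) (U : set 'rV[R]_n).

Lemma normrV_coord v i : `|v ord0 i| <= `|v|.
Proof.
have /mapP[j Hj ->] : `|v ord0 i| \in [seq `|v x.1 x.2| | x : 'I_1 * 'I_n].
  by apply/mapP; exists (ord0, i) => //=; rewrite mem_enum.
by rewrite [leRHS]/Num.norm /= mx_normrE; apply/bigmax_geP; right => /=; exists j.
Qed.

Lemma normrV_leP v (r : R) : 0 <= r ->
  `|v| <= r <-> forall i, `|v ord0 i| <= r.
Proof.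
move=> r0; split=> [vr i|vr]; first exact: le_trans (normrV_coord _ _) vr.
rewrite [leLHS]/Num.norm /= mx_normrE; apply/bigmax_leP; split=> // -[i j] _ /=.
by rewrite ord1.
Qed.

Lemma ball_rVE x (r : R) : 0 < r ->
  ball x r = [set y | forall i, ball (x ord0 i) r (y ord0 i)].
Proof.
move=> r0; apply/seteqP; split => [y [_ h] i|y h]; first exact: h.
by split => // i j; rewrite ord1; exact: h.
Qed.

Lemma measurable_box (A : 'I_n -> set R) : (forall i, measurable (A i)) ->
  measurable [set v : 'rV[R]_n | forall i, A i (v ord0 i)].
Proof.
move=> mA; rewrite (_ : mkset _ = \bigcap_(i in [set: 'I_n])
    (coord_rV i @^-1` A i)).
  apply: fin_bigcap_measurable => // i _.
  by rewrite -[X in measurable X]setTI; exact: measurable_coord_rV.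
by apply/seteqP; split => v /= h i; [move=> _; exact: h|exact: h].
Qed.

Lemma measurable_ball_rV x (r : R) : measurable (ball x r).
Proof.
have [r0|r0] := ltP 0 r; last first.
  rewrite (_ : ball _ _ = set0) //; apply/seteqP; split => // y [].
  by rewrite ltNge r0.
rewrite ball_rVE//; apply: (@measurable_box (fun i => ball (x ord0 i) r)) => i.
exact: measurable_ball.
Qed.

Lemma rat_rV_dense x (e : R) : 0 < e ->
  exists q : 'rV[rat]_n, ball x e (map_mx ratr q).
Proof.
move=> e0.
have /choice[q hq] : forall i, exists q : rat, ball (x ord0 i) e (ratr q).
  move=> i; have /rat_in_itvoo[q] : x ord0 i - e < x ord0 i + e by lra.
  rewrite in_itv/= => /andP[h1 h2]; exists q.
  by rewrite /ball/= ltr_norml; apply/andP; split; lra.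
exists (\row_i q i); rewrite ball_rVE// => i /=; rewrite !mxE; exact: hq.
Qed.

(** The sigma-algebra is generated by the coordinates, so countability must enter: U is the union of
    those balls with rational centre and radius 1/(k+1) that it contains. *)
Lemma open_measurable_rV U : open U -> measurable U.
Proof.
move=> oU.
pose F (p : 'rV[rat]_n * nat) : set 'rV[R]_n :=
  let B := ball (map_mx ratr p.1 : 'rV[R]_n) (p.2.+1%:R^-1) in
  if pselect (B `<=` U) then B else set0.
rewrite (_ : U = \bigcup_p F p).
  apply: countable_bigcupT_measurable => [|p]; first exact: countableP.
  by rewrite /F; case: pselect => [BU|BU] /=; [exact: measurable_ball_rV|exact: measurable0].
apply/seteqP; split => [x Ux|x [p _]]; last first.
  by rewrite /F; case: pselect => // /[apply].
have /nbhs_ballP[e /= e0 eU] : nbhs x U by exact: open_nbhs_nbhs.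
(* A ball of radius below e/2 that contains x stays within distance e of x, hence inside U. *)
have [k ke] : exists k : nat, k.+1%:R^-1 < e / 2.
  have /= := @near_infty_natSinv_lt R (PosNum (divr_gt0 e0 (ltr0n _ 2))).
  by case=> k _ /(_ k (leqnn k)); exists k.
have k0 : (0:R) < k.+1%:R^-1 by rewrite invr_gt0.
have [q xq] := rat_rV_dense x k0.
exists (q, k) => //; rewrite /F /=; case: pselect => [BU|[]] /=.
  exact: ball_sym.
move=> y qy; apply: eU; rewrite [e]splitr; apply: ball_triangle.
  by apply: le_ball xq; exact: ltW.
by apply: le_ball qy; exact: ltW.
Qed.

Lemma continuous_measurable_rV (f : 'rV[R]_n -> R) :
  continuous f -> measurable_fun setT f.
Proof.
move=> /continuousP cf; apply: (measurability _ (RGenOpens.measurableE R)).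
move=> _ [_ [a [b ->] <-]]; rewrite setTI.
apply: open_measurable_rV; apply: cf.
by have := @interval_open R (BRight a) (BLeft b); apply.
Qed.

(** Provides the open sets as generating pi-system for the Dynkin induction in [L1c_indic]. *)
Lemma measurable_rV_generated_open :
  @measurable _ 'rV[R]_n = <<s @open 'rV[R]_n >>.
Proof.
apply/seteqP; split; last first.
  apply: smallest_sub; last exact: open_measurable_rV.
  exact: sigma_algebra_measurable.
rewrite [X in X `<=` _](_ : _ = g_sigma_preimage (@coord_rV R n))//.
apply: smallest_sub; first exact: smallest_sigma_algebra.
rewrite -bigcup_seq/= => A [i _ [B mB <-]]; rewrite setTI.
have {mB} : (@RGenOpens.G R).-sigma.-measurable B.
  by rewrite -RGenOpens.measurableE.
(* Good-sets argument: the sets B whose preimage under the coordinate lies in the generated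
   sigma-algebra form a sigma-algebra containing the open intervals. *)
move: B; suff : <<s @RGenOpens.G R >> `<=`
    [set B | <<s @open 'rV[R]_n >> (coord_rV i @^-1` B)] by [].
apply: smallest_sub; last first.
  move=> _ [a [b ->]]; apply: sub_sigma_algebra.
  apply: (@open_comp _ _ (coord_rV i)); first by move=> v _; exact: coord_continuous.
  exact: (@interval_open R (BRight a) (BLeft b)).
split => /=.
- by rewrite preimage_set0; exact: sigma_algebra0.
- by move=> B hB; rewrite setTD preimage_setC -setTD; exact: sigma_algebraCD.
- by move=> F hF; rewrite preimage_bigcup; exact: sigma_algebra_bigcup.
Qed.

(** Boxes form a pi-system on which [lebesgue_rV] is a product of lengths, which is the form needed
    to compare two measures. *)
Lemma measurable_rV_generated_box :
  @measurable _ 'rV[R]_n =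
  <<s [set B | exists2 A : 'I_n -> set R, (forall i, measurable (A i)) &
        B = [set v : 'rV[R]_n | forall i, A i (v ord0 i)]] >>.
Proof.
apply/seteqP; split; last first.
  apply: smallest_sub; first exact: sigma_algebra_measurable.
  by move=> _ [A mA ->]; exact: measurable_box.
rewrite [X in X `<=` _](_ : _ = g_sigma_preimage (@coord_rV R n))//.
apply: (@sub_smallest2r _ (sigma_algebra setT)).
  exact: smallest_sigma_algebra.
rewrite -bigcup_seq/= => _ [i _ [B mB <-]]; rewrite setTI.
exists (fun j => if j == i then B else setT) => [j|]; first by case: ifP.
apply/seteqP; split => v /= h; first by move=> j; case: eqP => // ->.
by have := h i; rewrite eqxx.
Qed.

Lemma measurable_addrV (d : measure_display) (T : measurableType d)
    (f g : T -> 'rV[R]_n) : measurable_fun setT f -> measurable_fun setT g ->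
  measurable_fun setT (fun t => f t + g t).
Proof.
move=> /measurable_fun_rVP mf /measurable_fun_rVP mg; apply/measurable_fun_rVP => i.
under eq_fun do rewrite mxE; exact: measurable_funD.
Qed.

Lemma measurable_subrV (d : measure_display) (T : measurableType d)
    (f g : T -> 'rV[R]_n) : measurable_fun setT f -> measurable_fun setT g ->
  measurable_fun setT (fun t => f t - g t).
Proof.
move=> /measurable_fun_rVP mf /measurable_fun_rVP mg; apply/measurable_fun_rVP => i.
under eq_fun do rewrite !mxE; exact: measurable_funB.
Qed.

End rV_borel.

(** * Translation invariance of Lebesgue measure *)

Lemma lebesgue_measure_addr (R : realType) (c : R) (A : set R) :
  measurable A ->
  lebesgue_measure [set t | A (t + c)] = lebesgue_measure A.
Proof.
move=> mA.
have mc : measurable_fun [set: measurableTypeR R]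
    (fun t : measurableTypeR R => t + c : measurableTypeR R).
  exact: measurable_funD.
pose m := measure_function_pushforward__canonical__measure_function_Measure
  (@lebesgue_measure R) mc.
apply/esym; apply: (lebesgue_measure_unique (mu := m)) => // _ [[a b] _ <-] /=.
rewrite /pushforward /= (_ : _ @^-1` _ = `]a - c, b - c]%classic).
  rewrite !lebesgue_measure_itv /= !lte_fin ltrD2r; case: ifP => // _.
  by rewrite -!EFinB; congr EFin; lra.
by apply/seteqP; split => x /=; rewrite !in_itv/= => /andP[*]; apply/andP; split; lra.
Qed.

Section lebesgue_rV_translation.
Context {R : realType} {n : nat}.
Local Notation mu := (lebesgue_rV R n).
Implicit Types (v : 'rV[R]_n).

Lemma measurable_translate v :
  measurable_fun setT (fun x : 'rV[R]_n => x + v).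
Proof. by apply: measurable_addrV. Qed.

Lemma lebesgue_rV_translate v (A : set 'rV[R]_n) : measurable A ->
  mu [set x | A (x + v)] = mu A.
Proof.
pose m := measure_function_pushforward__canonical__measure_function_Measure
  mu (measurable_translate v).
move=> mA; rewrite -[LHS]/(m A); apply/esym; move: A mA.
(* Cubes of finite measure that exhaust the space, as uniqueness of a measure from its values on
   boxes demands. *)
pose g k := [set x : 'rV[R]_n | forall i, `[- k%:R, k%:R]%classic (x ord0 i)].
apply: (measure_unique _ g measurable_rV_generated_box) => //.
- move=> _ _ [A mA ->] [B mB ->]; exists (fun i => A i `&` B i).
    by move=> i; exact: measurableI.
  by apply/seteqP; split => [x [h1 h2] i|x h]; [split|split=> i; case: (h i)].
- by move=> k; exists (fun=> `[- k%:R, k%:R]%classic).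
- apply/seteqP; split => // x _; exists (Num.bound `|x|) => // i /=.
  rewrite in_itv/= -ler_norml (le_trans (normrV_coord _ _))//.
  by rewrite ltW// archi_boundP.
- move=> _ [A mA ->]; rewrite /m /= /pushforward.
  rewrite [LHS](lebesgue_rV_box mA).
  transitivity (mu [set x : 'rV[R]_n | forall i,
      [set t | A i (t + v ord0 i)] (x ord0 i)]); last first.
    congr (mu _); apply/seteqP.
    by split => x /= h i; have := h i; rewrite mxE.
  rewrite [RHS](lebesgue_rV_box (A := fun i => [set t | A i (t + v ord0 i)])).
    by apply: eq_bigr => i _; rewrite lebesgue_measure_addr.
  move=> i; rewrite -[X in measurable X]setTI.
  by apply: (@measurable_funD _ _ R setT id (cst (v ord0 i))).
- move=> k; rewrite [X in (X < _)%E](lebesgue_rV_box (A := fun=> `[- k%:R, k%:R]%classic))//.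
  rewrite (eq_bigr (fun=> (k%:R + k%:R)%:E)).
    by rewrite prodEFin ltry.
  move=> i _; rewrite lebesgue_measure_itv/= lte_fin.
  (* The second case is the degenerate interval, k = 0. *)
  case: ltP => [_|h]; first by rewrite -EFinB opprK.
  have k0 : (0:R) <= k%:R by exact: ler0n.
  by congr EFin; lra.
Qed.

Let integral_pushforward_translate v (f : 'rV[R]_n -> \bar R) :
  (\int[pushforward mu (fun x : 'rV[R]_n => (x + v)%R : 'rV[R]_n)]_x f x =
   \int[mu]_x f x)%E.
Proof.
pose m := measure_function_pushforward__canonical__measure_function_Measure
  mu (measurable_translate v).
apply: (@eq_measure_integral _ _ _ _ mu m) => A mA _.
exact: (lebesgue_rV_translate v mA).
Qed.

Lemma ge0_integral_translate v (f : 'rV[R]_n -> \bar R) :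
  measurable_fun setT f -> (forall x, 0 <= f x)%E ->
  (\int[mu]_x f (x + v)%R = \int[mu]_x f x)%E.
Proof.
move=> mf f0.
rewrite -[RHS](integral_pushforward_translate v).
by rewrite (ge0_integral_pushforward (measurable_translate v)) ?preimage_setT.
Qed.

Lemma integrable_translate v (f : 'rV[R]_n -> \bar R) :
  mu.-integrable setT f -> mu.-integrable setT (fun x => f (x + v)).
Proof.
move=> /integrableP[mf foo]; apply/integrableP; split.
  exact: (measurableT_comp mf (measurable_translate v)).
by rewrite (ge0_integral_translate v (f := fun x => `|f x|%E))//; exact: measurableT_comp.
Qed.

Lemma integral_translate v (f : 'rV[R]_n -> \bar R) :
  mu.-integrable setT f ->
  (\int[mu]_x f (x + v)%R = \int[mu]_x f x)%E.
Proof.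
move=> intf; have mf := measurable_int _ intf.
rewrite -[RHS](integral_pushforward_translate v).
rewrite (integral_pushforward (measurable_translate v)) ?preimage_setT//.
exact: integrable_translate.
Qed.

Lemma Rintegral_translate v (f : 'rV[R]_n -> R) :
  mu.-integrable setT (EFin \o f) ->
  \int[mu]_x f (x + v) = \int[mu]_x f x.
Proof. by move=> intf; congr fine; exact: (integral_translate v intf). Qed.

Lemma ae_translate v (P : set 'rV[R]_n) :
  {ae mu, forall x, P x} -> {ae mu, forall x, P (x + v)}.
Proof.
move=> [N [mN N0 PN]]; exists [set x | N (x + v)]; split => [||x /= h].
- by rewrite -[X in measurable X]setTI; exact: (measurable_translate v).
- by rewrite lebesgue_rV_translate.
- exact: PN.
Qed.

End lebesgue_rV_translation.

(** * The singular kernel *)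

Section kernel_integrable.
Context {R : realType} {n : nat}.
Local Notation mu := (lebesgue_rV R n).
Implicit Types (h : 'rV[R]_n).

Lemma lebesgue_rV_cube (r : R) : 0 <= r ->
  mu [set h | `|h| <= r] = ((2 * r) ^+ n)%:E.
Proof.
move=> r0.
rewrite (_ : [set h | _] =
    [set h : 'rV[R]_n | forall i, `[-r, r]%classic (h ord0 i)]).
  rewrite [LHS](lebesgue_rV_box (A := fun=> `[- r, r]%classic))//.
  rewrite (eq_bigr (fun=> (2 * r)%:E)) => [|i _].
    by rewrite prodEFin prodr_const card_ord.
  rewrite lebesgue_measure_itv/= lte_fin.
  by case: ltP => [_|h]; [rewrite -EFinB; congr EFin; lra|congr EFin; lra].
apply/seteqP; split => h /= hr.
  by move=> i /=; rewrite in_itv/= -ler_norml (le_trans (normrV_coord _ _)).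
by apply/(normrV_leP _ r0) => i; have := hr i; rewrite /= in_itv/= -ler_norml.
Qed.

Lemma measurable_normrV : measurable_fun setT (fun h : 'rV[R]_n => `|h|).
Proof. by apply: continuous_measurable_rV => h; exact: norm_continuous. Qed.

Lemma measurable_cube (r : R) : measurable [set h : 'rV[R]_n | `|h| <= r].
Proof.
rewrite -[X in measurable X]setTI.
have := measurable_normrV measurableT (measurable_itv `]-oo, r]).
by congr (measurable (_ `&` _)); apply/seteqP; split => h /=; rewrite in_itv.
Qed.

Lemma geometric_eseries_lty (C q : R) : 0 <= C -> 0 < q < 1 ->
  (\sum_(j <oo) (C * q ^+ j)%:E < +oo)%E.
Proof.
move=> C0 /andP[q0 q1].
apply: (@le_lt_trans _ _ (C * (1 - q)^-1)%:E); last exact: ltry.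
apply: lime_le.
  by apply: is_cvg_nneseries => j _ _; rewrite lee_fin mulr_ge0// exprn_ge0// ltW.
apply: nearW => k; rewrite sumEFin lee_fin.
by apply: (@geometric_le_lim R k C q) => //; rewrite ger0_norm// ltW.
Qed.

Lemma dyadic_gt1 (t : R) : 1 < t -> exists j, 2 ^+ j < t <= 2 ^+ j.+1.
Proof.
move=> t1.
have ex : exists j, t <= 2 ^+ j.
  exists (Num.bound t); rewrite (le_trans (ltW (archi_boundP _)))//; first lra.
  by rewrite -natrX ler_nat ltnW// ltn_expl.
case: (ex_minnP ex) => -[|j] hj jmin; first by rewrite expr0 in hj; lra.
exists j; rewrite hj andbT ltNge; apply/negP => /jmin; by rewrite ltnn.
Qed.

Lemma dyadic_le1 (t : R) : 0 < t <= 1 ->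
  exists j, 2^-1 ^+ j.+1 < t <= 2^-1 ^+ j.
Proof.
move=> /andP[t0]; rewrite le_eqVlt => /predU1P[->|t1].
  by exists 0%N; rewrite expr1 expr0; apply/andP; split; lra.
have /dyadic_gt1[j /andP[h1 h2]] : 1 < t^-1 by rewrite invf_gt1.
have p (i : nat) : 0 < (2 : R) ^+ i by rewrite exprn_gt0.
(* Inversion swaps the open and closed ends of the shell, so the endpoint belongs to the next
   index. *)
have [e|ne] := eqVneq t^-1 (2 ^+ j.+1).
  exists j.+1; rewrite -[t]invrK e !exprVn lexx andbT ltf_pV2 ?posrE//.
  by rewrite ltr_eXn2l// ltr1n.
exists j; rewrite !exprVn -[t]invrK ltf_pV2 ?lef_pV2 ?posrE ?invr_gt0//.
by rewrite (ltW h1) andbT lt_neqAle ne.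
Qed.

Lemma powR_exprn (a s : R) j : 0 <= a -> (a ^+ j) `^ s = (a `^ s) ^+ j.
Proof.
move=> a0; rewrite -powR_mulrn// -powRrM mulrC powRrM powR_mulrn//.
exact: powR_ge0.
Qed.

(* If eta takes values in [0, 1] and is s-Lipschitz, then
   |eta (x + h) - eta x| / |h|^(n + alpha) <= frac_kernel alpha s h. *)
Definition frac_kernel (alpha s : R) h : R :=
  Num.min 1 (s * `|h|) / `|h| `^ (n%:R + alpha).

Lemma frac_kernel_ge0 alpha s h : 0 <= s -> 0 <= frac_kernel alpha s h.
Proof.
move=> s0; rewrite divr_ge0 ?powR_ge0// le_min ler01/=.
by rewrite mulr_ge0.
Qed.

Lemma measurable_frac_kernel alpha s :
  measurable_fun setT (frac_kernel alpha s).
Proof.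
apply: measurable_funM.
  apply: measurable_minr => //; apply: measurable_funM => //.
  exact: measurable_normrV.
have -> : (fun h : 'rV[R]_n => (`|h| `^ (n%:R + alpha))^-1) =
    (fun t : R => t `^ (- (n%:R + alpha))) \o (fun h => `|h|).
  by apply/funext => h /=; rewrite powRN.
apply: measurableT_comp; last exact: measurable_normrV.
exact: measurable_powR.
Qed.

(* The first term of u j dominates frac_kernel alpha 1 on the dyadic shell
   2^j < |h| <= 2^(j+1), the second one on 2^-(j+1) < |h| <= 2^-j. *)
Let u (alpha : R) j h : R :=
  ((2 `^ (n%:R + alpha))^-1 ^+ j) * \1_[set h | `|h| <= 2 ^+ j.+1] h +
  (2^-1 ^+ j * (2 `^ (n%:R + alpha)) ^+ j.+1) *
    \1_[set h | `|h| <= 2^-1 ^+ j] h.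

Let u_ge0 alpha j h : 0 <= u alpha j h.
Proof.
rewrite addr_ge0// !mulr_ge0// ?exprn_ge0// ?invr_ge0 ?powR_ge0//.
Qed.

Let frac_kernel_le_u (alpha : R) h : 0 < alpha -> exists j,
  frac_kernel alpha 1 h <= u alpha j h.
Proof.
move=> a0; set s := n%:R + alpha.
have s0 : 0 < s by rewrite ltr_wpDl.
have A0 : 0 < 2 `^ s :> R by rewrite powR_gt0.
have [->|h0] := eqVneq h 0.
  (* At h = 0 the minimum vanishes, so the kernel has value 0 and any index works. *)
  exists 0%N; rewrite /frac_kernel normr0 mulr0 (_ : Num.min _ _ = 0) ?mul0r//.
  by rewrite min_r.
rewrite /frac_kernel mul1r; set t := `|h|.
have t0 : 0 < t by rewrite normr_gt0.
have [t1|t1] := leP t 1; last first.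
  have [j /andP[j1 j2]] := dyadic_gt1 t1; exists j.
  rewrite /u -/s ler_wpDr// ?mulr_ge0// ?exprn_ge0// ?(ltW A0)//.
  rewrite indicE mem_set// mulr1 mul1r exprVn.
  rewrite lef_pV2 ?posrE ?powR_gt0 ?exprn_gt0//.
  by rewrite -powR_exprn// ge0_ler_powR ?nnegrE ?exprn_ge0// ltW.
have [|j /andP[j1 j2]] := @dyadic_le1 t; first by rewrite t0.
exists j; rewrite /u -/s ler_wpDl ?mulr_ge0 ?exprn_ge0 ?invr_ge0 ?(ltW A0)//.
rewrite indicE mem_set// mulr1 ler_pM ?invr_ge0 ?powR_ge0 ?(ltW t0)//.
rewrite -[leRHS]invrK -exprVn lef_pV2 ?posrE ?powR_gt0 ?exprn_gt0 ?invr_gt0//.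
have -> : (2 `^ s)^-1 = (2^-1) `^ s :> R.
  by rewrite -powRN -mulN1r powRrM powR_inv1.
rewrite -powR_exprn ?invr_ge0// ge0_ler_powR ?nnegrE ?exprn_ge0 ?invr_ge0// ltW//.
Qed.

Lemma integral_cube_indic (c r : R) : 0 <= c -> 0 <= r ->
  (\int[mu]_h (c * \1_[set h | (`|h| <= r)%R] h)%:E = (c * (2 * r) ^+ n)%:E)%E.
Proof.
move=> c0 r0; under eq_integral do rewrite EFinM.
rewrite ge0_integralZl_EFin//; last first.
  by apply/measurable_EFinP; exact: measurable_indic (measurable_cube _).
rewrite integral_indic//; last exact: measurable_cube.
rewrite EFinM; congr (_ * _)%E.
by rewrite setIT; exact: lebesgue_rV_cube.
Qed.

(** The volume of the cube cancels the n in the exponent. What remains has ratio 2^(-alpha) for the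
    far shells and 2^(alpha-1) for the near ones, both below 1 when 0 < alpha < 1. *)
Let integral_u (alpha : R) j : (\int[mu]_h (u alpha j h)%:E)%E =
  ((4 ^+ n) * (2 `^ (- alpha)) ^+ j +
   (2 ^+ n * 2 `^ (n%:R + alpha)) * (2 `^ (alpha - 1)) ^+ j)%:E.
Proof.
have A0 : 0 < 2 `^ (n%:R + alpha) :> R by rewrite powR_gt0.
have mc (c r : R) : measurable_fun setT
    (fun h : 'rV[R]_n => (c * \1_[set h | (`|h| <= r)%R] h)%:E).
  apply/measurable_EFinP/measurable_funM => //.
  exact: measurable_indic (measurable_cube _).
under eq_integral do rewrite /u EFinD.
rewrite ge0_integralD//.
rewrite !integral_cube_indic ?mulr_ge0 ?exprn_ge0 ?invr_ge0 ?(ltW A0)//.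
rewrite -EFinD; congr EFin.
pose P : R := 2 ^+ n; pose Q : R := 2 `^ alpha.
have P0 : P != 0 by rewrite expf_neq0// pnatr_eq0.
have Q0 : Q != 0 by rewrite gt_eqF// powR_gt0.
have AE : 2 `^ (n%:R + alpha) = P * Q :> R.
  by rewrite powRD ?pnatr_eq0 ?implybT// powR_mulrn.
congr (_ + _).
  have -> : (2 * 2 ^+ j.+1 : R) ^+ n = 4 ^+ n * P ^+ j.
    by rewrite exprS mulrA -natrM exprMn /P -!exprM mulnC.
  by rewrite AE powRN invfM !exprMn !exprVn; field; rewrite !expf_neq0.
rewrite [in LHS]AE exprS powRB ?pnatr_eq0 ?implybT// powRr1// -/Q.
have -> : (2 * 2^-1 ^+ j : R) ^+ n = 2 ^+ n * (P ^+ j)^-1.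
  by rewrite exprMn /P -!exprM mulnC exprVn.
by rewrite AE !exprMn !exprVn -/P; field; rewrite !expf_neq0// pnatr_eq0.
Qed.

Lemma integrable_frac_kernel1 (alpha : R) : 0 < alpha < 1 ->
  mu.-integrable setT (EFin \o frac_kernel alpha 1).
Proof.
move=> /andP[a0 a1]; apply/integrableP; split.
  by apply/measurable_EFinP; exact: measurable_frac_kernel.
have mu_ j : measurable_fun setT (EFin \o u alpha j).
  apply/measurable_EFinP; apply: measurable_funD; apply: measurable_funM => //;
    exact: measurable_indic (measurable_cube _).
apply: (@le_lt_trans _ _ (\int[mu]_h (\sum_(j <oo) (u alpha j h)%:E))%E).
  apply: ge0_le_integral => //.
  - apply: measurableT_comp => //; apply/measurable_EFinP.
    exact: measurable_frac_kernel.
  - apply: (ge0_emeasurable_sum (h := fun j h => (u alpha j h)%:E)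
      (P := xpredT)) => [j h hT jT|j jT]; [by rewrite lee_fin|exact: mu_].
  move=> h _ /=; rewrite ger0_norm ?frac_kernel_ge0//.
  have [j kj] := frac_kernel_le_u h a0.
  (* All terms are nonnegative, so the single term that dominates the kernel at h is below the whole
     series. *)
  apply: (@le_trans _ _ (\sum_(0 <= i < j.+1) (u alpha i h)%:E)%E).
    by rewrite sumEFin lee_fin big_nat_recr//= ler_wpDl// sumr_ge0.
  by apply: nneseries_lim_ge => i _ _; rewrite lee_fin.
rewrite integral_nneseries//; last by move=> j h _; rewrite lee_fin.
under eq_eseriesr do rewrite integral_u EFinD.
rewrite nneseriesD; last 2 first.
- by move=> j _ _; rewrite lee_fin mulr_ge0// exprn_ge0// powR_ge0.
- by move=> j _ _; rewrite lee_fin !mulr_ge0 ?exprn_ge0 ?powR_ge0.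
have q01 (s : R) : 0 < s -> 0 < 2 `^ (- s) < 1.
  move=> s0; rewrite powR_gt0//= powRN invf_lt1 ?powR_gt0//.
  have /(_ 1 2) := gt0_ltr_powR s0; rewrite powR1; apply.
  - by rewrite nnegrE.
  - by rewrite nnegrE.
  - by rewrite ltr1n.
rewrite lte_add_pinfty// geometric_eseries_lty ?mulr_ge0 ?exprn_ge0 ?powR_ge0//.
  exact: q01.
by rewrite -opprB; apply: q01; lra.
Qed.

(** Reduces to slope 1 through min(1, s t) <= max(1, s) min(1, t). *)
Lemma integrable_frac_kernel (alpha s : R) : 0 < alpha < 1 -> 0 <= s ->
  mu.-integrable setT (EFin \o frac_kernel alpha s).
Proof.
move=> a01 s0.
apply: (le_integrable measurableT _ _
  (integrableZl measurableT (Num.max 1 s) (integrable_frac_kernel1 a01))).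
  by apply/measurable_EFinP; exact: measurable_frac_kernel.
have m0 : 0 <= Num.max 1 s by rewrite le_max ler01.
move=> h _ /=; rewrite lee_fin ger0_norm ?frac_kernel_ge0// ger0_norm.
  rewrite mulrA ler_wpM2r ?invr_ge0 ?powR_ge0//.
  have [h1|h1] := leP 1 (1 * `|h|).
    by rewrite mulr1 ge_min le_max lexx.
  rewrite ge_min; apply/orP; right.
  by rewrite mul1r ler_wpM2r// le_max lexx orbT.
by apply: mulr_ge0 => //; exact: frac_kernel_ge0.
Qed.

(** This is the source of c_k -> 0. For fixed h the kernel is at most a constant times 1/(k+1), and
    the kernel of slope L dominates all of them. *)
Lemma cvg_integral_frac_kernel (alpha : R) (L : R) : 0 < alpha < 1 -> 0 <= L ->
  (\int[mu]_h (frac_kernel alpha (L / k.+1%:R) h)%:E)%E @[k --> \oo] --> 0%E.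
Proof.
move=> a01 L0.
have Lk0 k : 0 <= L / k.+1%:R by rewrite divr_ge0.
have [] := @dominated_convergence _ _ _ mu _ measurableT
  (fun k => EFin \o frac_kernel alpha (L / k.+1%:R)) (cst 0%E)
  (EFin \o frac_kernel alpha L).
- by move=> k; apply/measurable_EFinP; exact: measurable_frac_kernel.
- exact: measurable_cst.
- apply: aeW => /= h _; apply/fine_cvgP; split; first exact: nearW.
  apply: (@squeeze_cvgr _ _ _ _ (cst 0)
    (fun k => (L * `|h| / `|h| `^ (n%:R + alpha)) * k.+1%:R^-1)).
  + apply: nearW => k /=; rewrite frac_kernel_ge0//=.
    rewrite [leRHS](_ : _ = L / k.+1%:R * `|h| / `|h| `^ (n%:R + alpha)).
      by rewrite ler_wpM2r ?invr_ge0 ?powR_ge0// ge_min lexx orbT.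
    by ring.
  + exact: cvg_cst.
  + rewrite -[X in _ --> X](mulr0 (L * `|h| / `|h| `^ (n%:R + alpha))).
    by apply: cvgMr; exact: cvg_harmonic.
- exact: integrable_frac_kernel.
- apply: aeW => /= h k _; rewrite lee_fin ger0_norm ?frac_kernel_ge0//.
  rewrite ler_wpM2r ?invr_ge0 ?powR_ge0// le_min ge_min lexx/=.
  rewrite ge_min; apply/orP; right; rewrite ler_wpM2r//.
  by rewrite ler_pdivrMr// ler_peMr// ler1n.
by move=> _ _; rewrite integral_cst//= mul0e.
Qed.

End kernel_integrable.

Lemma cvge0_near (R : realType) (u : nat -> \bar R) :
  (forall k, 0 <= u k)%E ->
  (forall e : R, 0 < e -> \forall k \near \oo, (u k <= e%:E)%E) ->
  u @ \oo --> 0%E.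
Proof.
move=> u0 ue; apply/fine_cvgP; split.
  near=> k; rewrite ge0_fin_numE//.
  by apply: (@le_lt_trans _ _ 1%:E); [near: k; exact: ue|exact: ltry].
apply/cvgr0Pnorm_le => e e0; near=> k => /=.
have uke : (u k <= e%:E)%E by near: k; exact: ue.
rewrite ger0_norm ?fine_ge0// -lee_fin fineK//.
by rewrite ge0_fin_numE// (le_lt_trans uke)// ltry.
Unshelve. all: by end_near. Qed.

Lemma near_le_cvge0 (R : realType) (u : nat -> \bar R) (e : R) :
  (forall k, 0 <= u k)%E -> u @ \oo --> 0%E -> 0 < e ->
  \forall k \near \oo, (u k <= e%:E)%E.
Proof.
move=> u0 /fine_cvgP[ufin /cvgr0Pnorm_le ue] e0; near=> k.
have uk : u k \is a fin_num by near: k.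
rewrite -(fineK uk) lee_fin -[leLHS]ger0_norm ?fine_ge0//.
by near: k; exact: ue.
Unshelve. all: by end_near. Qed.

(** * Continuity of translations in L^1 *)

Section L1_translation.
Context {R : realType} {n : nat}.
Local Notation mu := (lebesgue_rV R n).
Implicit Types (f g : 'rV[R]_n -> R) (A : set 'rV[R]_n).

Definition L1_translation_continuous f :=
  forall z_ : nat -> 'rV[R]_n, z_ @ \oo --> (0 : 'rV[R]_n) ->
  (\int[mu]_x (`|f (x + z_ k)%R - f x|)%:E)%E @[k --> \oo] --> 0%E.

Local Notation L1c := L1_translation_continuous.

Lemma measurable_translate_diff f (z : 'rV[R]_n) : measurable_fun setT f ->
  measurable_fun setT (fun x : 'rV[R]_n => (`|f (x + z)%R - f x|)%:E).
Proof.
move=> mf; apply/measurable_EFinP; apply: measurableT_comp => //.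
apply: measurable_funB => //.
exact: (measurableT_comp mf (measurable_translate z)).
Qed.

Lemma L1c_add f g : measurable_fun setT f -> measurable_fun setT g ->
  L1c f -> L1c g -> L1c (f \+ g).
Proof.
move=> mf mg cf cg z_ z0.
apply: (@squeeze_cvge _ _ _ _ (cst 0%E) _
  (fun k => \int[mu]_x (`|f (x + z_ k)%R - f x|)%:E +
            \int[mu]_x (`|g (x + z_ k)%R - g x|)%:E)%E).
- apply: nearW => k; rewrite integral_ge0//=.
  rewrite -ge0_integralD//; try exact: measurable_translate_diff.
  apply: ge0_le_integral => //.
  + exact: (measurable_translate_diff _ (measurable_funD mf mg)).
  + by apply: emeasurable_funD; exact: measurable_translate_diff.
  move=> x _; rewrite -EFinD lee_fin opprD addrACA; exact: ler_normD.
- exact: cvg_cst.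
- rewrite -[X in _ --> X]adde0; apply: cvgeD => //; [exact: cf|exact: cg].
Qed.

Lemma L1c_scale (c : R) f : measurable_fun setT f -> L1c f ->
  L1c (fun x => c * f x).
Proof.
move=> mf cf z_ z0.
have -> : (fun k => \int[mu]_x (`|c * f (x + z_ k)%R - c * f x|)%:E)%E =
    (fun k => `|c|%:E * \int[mu]_x (`|f (x + z_ k)%R - f x|)%:E)%E.
  apply/funext => k; rewrite -ge0_integralZl_EFin//; last first.
    exact: measurable_translate_diff.
  by apply: eq_integral => x _; rewrite -EFinM -mulrBr normrM.
rewrite -[X in _ --> X](mule0 `|c|%:E); apply: cvgeMl => //; exact: cf.
Qed.

(** An e/3 argument: by translation invariance the approximation error is the same before and after
    translating. *)
Lemma L1c_approx f : measurable_fun setT f ->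
  (forall e : R, 0 < e -> exists g, [/\ measurable_fun setT g, L1c g &
     (\int[mu]_x (`|f x - g x|)%:E <= e%:E)%E]) -> L1c f.
Proof.
move=> mf fg z_ z0; apply: cvge0_near => [k|e e0]; first exact: integral_ge0.
have e3 : 0 < e / 3 by rewrite divr_gt0.
have [g [mg cg fge]] := fg _ e3.
have gz : \forall k \near \oo,
    (\int[mu]_x (`|g (x + z_ k)%R - g x|)%:E <= (e / 3)%:E)%E.
  by apply: near_le_cvge0 (cg _ z0) e3 => k; exact: integral_ge0.
apply: filterS gz => k gk.
have mfg : measurable_fun setT (fun x => (`|f x - g x|)%:E).
  by apply/measurable_EFinP; apply: measurableT_comp => //; exact: measurable_funB.
apply: (@le_trans _ _ (\int[mu]_x ((`|f (x + z_ k)%R - g (x + z_ k)%R|)%:E +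
  ((`|f x - g x|)%:E + (`|g (x + z_ k)%R - g x|)%:E)))%E).
  apply: ge0_le_integral => //.
  - exact: measurable_translate_diff.
  - apply: emeasurable_funD.
      exact: (measurableT_comp mfg (measurable_translate (z_ k))).
    by apply: emeasurable_funD => //; exact: measurable_translate_diff.
  move=> x _; rewrite -!EFinD lee_fin.
  rewrite [X in `|X|](_ : _ = (f (x + z_ k) - g (x + z_ k)) -
     ((f x - g x) - (g (x + z_ k) - g x))); last by ring.
  apply: le_trans (ler_normB _ _) _; rewrite lerD2l; exact: ler_normB.
rewrite ge0_integralD//; last 3 first.
- exact: (measurableT_comp mfg (measurable_translate (z_ k))).
- by move=> x Dx; rewrite adde_ge0.
- by apply: emeasurable_funD => //; exact: measurable_translate_diff.
rewrite ge0_integralD//; last exact: measurable_translate_diff.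
rewrite (ge0_integral_translate (z_ k) mfg)//.
rewrite (_ : e = e / 3 + (e / 3 + e / 3)); last by field.
by rewrite !EFinD !leeD.
Qed.

Lemma integrable_indic_lty A : measurable A -> (mu A < +oo)%E ->
  mu.-integrable setT (EFin \o \1_A).
Proof.
move=> mA Afin; apply/integrableP; split.
  exact/measurable_EFinP/measurable_indic.
under eq_integral do rewrite /= ger0_norm//.
by rewrite integral_indic// setIT.
Qed.

(** On the boundary of A the difference of indicators need not converge to 0. The part lost from A,
    [v] below, does so at every point because A is open, and equality of measures makes the part
    gained as large as the part lost. *)
Lemma L1c_indic_open A : open A -> (mu A < +oo)%E -> L1c \1_A.
Proof.
move=> oA Afin z_ z0.
have mA := open_measurable_rV oA.
have iA : mu.-integrable setT (EFin \o \1_A).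
  exact: integrable_indic_lty.
have m1z k : measurable_fun setT (fun x : 'rV[R]_n => \1_A (x + z_ k)%R : R).
  exact: (measurableT_comp (measurable_indic mA) (measurable_translate (z_ k))).
pose v k x : \bar R := (\1_A x * (1 - \1_A (x + z_ k)))%:E.
have mv k : measurable_fun setT (v k).
  apply/measurable_EFinP/measurable_funM; first exact: measurable_indic.
  exact: measurable_funB.
have vA k x : (`|v k x| <= (EFin \o \1_A) x)%E.
  rewrite /v /= lee_fin !indicE; do 2 case: (_ \in _) => /=;
    by rewrite ?(subrr, subr0, mulr1, mulr0, normr0, normr1, mul0r).
have iv k : mu.-integrable setT (v k).
  apply: (le_integrable measurableT (mv k) _ iA) => x _ /=.
  apply: (le_trans (vA k x)); rewrite lee_fin; exact: ler_norm.
(* |a - b| = 2 b (1 - a) + (a - b) for a, b in {0, 1}; as mu A is finite and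
   translation invariant, the last term has integral 0. *)
have -> : (fun k => \int[mu]_x (`|\1_A (x + z_ k)%R - \1_A x|)%:E)%E =
    (fun k => 2%:E * \int[mu]_x v k x)%E.
  apply/funext => k.
  transitivity (\int[mu]_x (2%:E * v k x +
      ((\1_A (x + z_ k)%R)%:E - (\1_A x)%:E)))%E.
    apply: eq_integral => x _; rewrite /v -EFinM -EFinB -EFinD !indicE.
    congr EFin; do 2 case: (_ \in _) => /=;
    rewrite ?(subrr, subr0, mulr1, mulr0, normr0, normr1, mul0r, mul1r, sub0r,
      normrN1, addr0, add0r)//; lra.
  have i1 := integrable_translate (z_ k) iA.
  rewrite integralD//; last 2 first.
  - exact: integrableZl.
  - exact: integrableB.
  rewrite integralZl// integralB// (integral_translate (z_ k) iA) subee ?adde0//.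
  exact: integrable_fin_num.
rewrite -[X in _ --> X](mule0 2%:E); apply: cvgeMl => //.
have [] := @dominated_convergence _ _ _ mu _ measurableT v (cst 0%E)
  (EFin \o \1_A) mv (measurable_cst _) _ iA _.
- apply: aeW => x _; apply: cvg_near_cst.
  have [Ax|nAx] := pselect (A x); last first.
    by apply: nearW => k; rewrite /v indicE memNset// mul0r.
  have xz : x + z_ k @[k --> \oo] --> x.
    by rewrite -[X in _ --> X]addr0; apply: cvgD => //; exact: cvg_cst.
  have : \forall k \near \oo, A (x + z_ k) by exact/xz/open_nbhs_nbhs.
  by apply: filterS => k Ak; rewrite /v !indicE !mem_set// subrr mulr0.
- by apply: aeW => x k _.
by move=> _ _; rewrite integral_cst//= mul0e.
Qed.

(** Intersecting with a ball keeps measures finite, so that complements and countable unions can be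
    handled in the induction below. *)
Let ballR (m : nat) : set 'rV[R]_n := ball (0 : 'rV[R]_n) m.+1%:R.

Let mu_ballR A m : measurable A -> (mu (A `&` ballR m) < +oo)%E.
Proof.
move=> mA; apply: (@le_lt_trans _ _ (mu [set h | `|h| <= m.+1%:R])).
  apply: le_measure; rewrite ?inE.
  - by apply: measurableI => //; exact: measurable_ball_rV.
  - exact: measurable_cube.
  - move=> x [_]; rewrite /ballR mx_norm_ball /ball_/= sub0r normrN.
    by move=> /ltW.
by rewrite lebesgue_rV_cube// ltry.
Qed.

(* Translation continuity passes to complements and disjoint unions, and the
   open sets generate: this is a Dynkin induction. *)
Lemma L1c_indic A m : measurable A -> L1c \1_(A `&` ballR m).
Proof.
rewrite measurable_rV_generated_open; move: A.
have mB := @measurable_ball_rV R n 0 m.+1%:R.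
apply: dynkin_induction => //.
- exact: measurable_rV_generated_open.
- exact: openI.
- by rewrite setTI; apply: L1c_indic_open; [exact: ball_open|
    rewrite -[X in mu X]setTI; exact: mu_ballR].
- move=> U oU; apply: L1c_indic_open.
    by apply: openI => //; exact: ball_open.
  by apply: mu_ballR; exact: open_measurable_rV.
- move=> S mS cS.
  rewrite (_ : \1_(~` S `&` ballR m) =
      \1_(setT `&` ballR m) \+ (fun x => -1 * \1_(S `&` ballR m) x)).
    apply: L1c_add.
    + by apply: measurable_indic; exact: measurableI.
    + by apply: measurable_funM => //; apply: measurable_indic; exact: measurableI.
    + by rewrite setTI; apply: L1c_indic_open; [exact: ball_open|
        rewrite -[X in mu X]setTI; exact: mu_ballR].
    + by apply: L1c_scale => //; apply: measurable_indic; exact: measurableI.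
  apply/funext => x /=; rewrite setTI !indicE !in_setI in_setC.
  by case: (x \in S); case: (x \in ballR m) => /=; lra.
(* Countable disjoint unions: the finite ones have sums of indicators, and they converge in L^1 to
   the whole, dominated by the indicator of the ball. *)
- move=> F mF tF cF.
  have mS k : measurable (\big[setU/set0]_(i < k) F i).
    by apply: bigsetU_measurable => i _.
  have mU : measurable (\bigcup_k F k) by exact: bigcupT_measurable.
  apply: L1c_approx => [|e e0].
    by apply: measurable_indic; exact: measurableI.
  have cS k : L1c \1_((\big[setU/set0]_(i < k) F i) `&` ballR m).
    elim: k => [|k IHk].
      rewrite big_ord0 set0I indic0 => z_ z0.
      under eq_fun do under eq_integral do rewrite subrr normr0.
      by under eq_fun do rewrite integral0; exact: cvg_cst.
    rewrite big_ord_recr/=.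
    rewrite (_ : \1__ = \1_((\big[setU/set0]_(i < k) F i) `&` ballR m) \+
        \1_(F k `&` ballR m)).
      by apply: L1c_add => //; apply: measurable_indic; exact: measurableI.
    apply/funext => x /=; move: (ballR m) => B.
    rewrite !indicE !in_setI in_setU.
    have : ~~ ((x \in \big[setU/set0]_(i < k) F i) && (x \in F k)).
      apply/negP => /andP[]; rewrite !inE -bigcup_mkord => -[i /= ik Fix] Fkx.
      have /trivIsetP/(_ i k Logic.I Logic.I) := tF.
      rewrite neq_ltn ik => /(_ isT) FiFk.
      by have : set0 x by rewrite -FiFk.
    case: (x \in \big[setU/set0]_(i < k) F i) => /=.
      by move=> /negbTE->; rewrite addr0.
    by rewrite add0r.
  have iB : mu.-integrable setT (EFin \o \1_(ballR m)).
    apply: integrable_indic_lty => //; rewrite -[X in mu X]setTI.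
    exact: mu_ballR.
  have [] := @dominated_convergence _ _ _ mu _ measurableT
    (fun k => EFin \o \1_((\big[setU/set0]_(i < k) F i) `&` ballR m))
    (EFin \o \1_((\bigcup_k F k) `&` ballR m)) (EFin \o \1_(ballR m)) _ _ _ iB _.
  + by move=> k; apply/measurable_EFinP/measurable_indic; exact: measurableI.
  + by apply/measurable_EFinP/measurable_indic; exact: measurableI.
  + apply: aeW => x _; apply: cvg_near_cst.
    have [[i _ Fix]|nFx] := pselect ((\bigcup_k F k) x).
      exists i.+1 => // k /= ik; rewrite !indicI /= ![\1_(_ _) x]indicE.
      rewrite [x \in \bigcup_k F k]mem_set ?mem_set//; last by exists i.
      by rewrite -bigcup_mkord; exists i.
    apply: nearW => k /=; rewrite !indicI /= !indicE.
    rewrite [x \in \bigcup_k F k]memNset// [x \in \big[setU/set0]_(i < k) F i]memNset//.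
    by apply: contra_not nFx; rewrite -bigcup_mkord => -[i _ Fix]; exists i.
  + apply: aeW => x k _ /=; rewrite lee_fin indicI /= normrM !indicE !normr_nat.
    by rewrite ler_piMl// lern1 leq_b1.
  move=> _ + _ => /near_le_cvge0 => /(_ _ _ e0)[k|N _ /(_ N (leqnn N)) hN].
    by apply: integral_ge0.
  exists \1_((\big[setU/set0]_(i < N) F i) `&` ballR m); split => //.
    by apply: measurable_indic; exact: measurableI.
  apply: le_trans hN; rewrite le_eqVlt; apply/orP; left; apply/eqP.
  by apply: eq_integral => x _ /=; rewrite distrC.
Qed.

Import HBSimple.

Lemma L1c_sum (I : Type) (s : seq I) (h : I -> 'rV[R]_n -> R) :
  (forall i, measurable_fun setT (h i)) -> (forall i, L1c (h i)) ->
  L1c (fun x => \sum_(i <- s) h i x).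
Proof.
move=> mh ch; elim: s => [|i s IHs].
  under eq_fun do rewrite big_nil.
  move=> z_ z0; under eq_fun do under eq_integral do rewrite subrr normr0.
  by under eq_fun do rewrite integral0; exact: cvg_cst.
under eq_fun do rewrite big_cons.
by apply: L1c_add => //; exact: measurable_sum.
Qed.

(** Level sets of g may be unbounded. Truncating g to a large ball costs little in L^1 and leaves a
    finite combination of the indicators treated in [L1c_indic]. *)
Lemma L1c_sfun (g : {sfun 'rV[R]_n >-> R}) :
  mu.-integrable setT (EFin \o g) -> L1c g.
Proof.
move=> ig; apply: L1c_approx => // e e0.
have mB m : measurable (ballR m) by exact: measurable_ball_rV.
have mgB m : measurable_fun setT (fun x => g x * \1_(ballR m) x).
  by apply: measurable_funM => //; exact: measurable_indic.
have [] := @dominated_convergence _ _ _ mu _ measurableT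
  (fun m x => (g x * \1_(ballR m) x)%:E) (EFin \o g) (abse \o (EFin \o g)) _ _ _ _ _.
- by move=> m; exact/measurable_EFinP.
- exact: measurable_int ig.
- apply: aeW => x _; apply: cvg_near_cst.
  near=> m; rewrite indicE mem_set ?mulr1//= /ballR mx_norm_ball /ball_/=.
  rewrite sub0r normrN (lt_le_trans (archi_boundP _))// ler_nat.
  by rewrite leqW//; near: m; exact: nbhs_infty_ge.
- exact: integrable_abse.
- apply: aeW => x m _ /=; rewrite lee_fin normrM indicE.
  by case: (_ \in _); rewrite ?normr0 ?normr1 ?mulr0 ?mulr1.
move=> _ + _ => /near_le_cvge0 => /(_ _ _ e0)[k|N _ /(_ N (leqnn N)) hN].
  by apply: integral_ge0.
exists (fun x => g x * \1_(ballR N) x); split => //; last first.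
  apply: le_trans hN; rewrite le_eqVlt; apply/orP; left; apply/eqP.
  by apply: eq_integral => x _ /=; rewrite distrC.
have -> : (fun x => g x * \1_(ballR N) x) = (fun x =>
    \sum_(r <- finmap.enum_fset (fset_set (range g))) r * \1_(g @^-1` [set r] `&` ballR N) x).
  apply/funext => x; rewrite fimfunE fsbig_finite//= mulr_suml.
  by apply: eq_bigr => r _; rewrite -mulrA indicI.
apply: L1c_sum => r.
  by apply: measurable_funM => //; apply: measurable_indic; exact: measurableI.
apply: L1c_scale; first by apply: measurable_indic; exact: measurableI.
exact: L1c_indic.
Unshelve. all: by end_near. Qed.

Lemma integrable_L1_translation_continuous f :
  mu.-integrable setT (EFin \o f) -> L1c f.
Proof.
move=> intf; apply: L1c_approx => [|e e0].
  by apply/measurable_EFinP; exact: measurable_int intf.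
have [g_ [ig _ gf]] := approximation_sfun_integrable measurableT intf.
have [k|N _ /(_ N (leqnn N)) hN] := near_le_cvge0 _ gf e0.
  exact: integral_ge0.
by exists (g_ N); split => //; exact: L1c_sfun.
Qed.

(** The modulus form is what fixes a mollification scale. If no d worked, vectors z_k with |z_k| <=
    1/(k+1) would contradict sequential continuity. *)
Lemma L1_translation_modulus f : mu.-integrable setT (EFin \o f) ->
  forall e : R, 0 < e -> exists2 d : R, 0 < d & forall z : 'rV[R]_n, `|z| <= d ->
    (\int[mu]_x (`|f (x + z)%R - f x|)%:E <= e%:E)%E.
Proof.
move=> intf e e0; apply: contrapT => /forall2NP H.
have /choice[z_ hz] : forall k : nat, exists z : 'rV[R]_n, `|z| <= k.+1%:R^-1 /\
    ~ (\int[mu]_x (`|f (x + z)%R - f x|)%:E <= e%:E)%E.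
  move=> k; have [|] := H k.+1%:R^-1; first by rewrite invr_gt0.
  by move=> /existsNP[z /not_implyP[]]; exists z.
have z0 : z_ @ \oo --> (0 : 'rV[R]_n).
  apply/cvgr0Pnorm_le => d d0; near=> k.
  apply: (le_trans (hz k).1); apply: ltW; near: k.
  exact: near_infty_natSinv_lt (PosNum d0).
have cf := integrable_L1_translation_continuous intf.
have [k|N _ /(_ N (leqnn N)) hN] := near_le_cvge0 _ (cf _ z0) e0.
  exact: integral_ge0.
by case: (hz N).
Unshelve. all: by end_near. Qed.

End L1_translation.

Lemma translate_continuous (R : realType) n (v : 'rV[R]_n) :
  continuous (fun x : 'rV[R]_n => x + v).
Proof.
move=> x; have -> : (fun x : 'rV[R]_n => x + v) = id + cst v by [].
apply: continuousD; [exact: cvg_id|exact: cst_continuous].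
Qed.

(** * Smooth functions *)

Section smooth_coinduction.
Context {R : realType} {n : nat} {W : normedModType R}.

Lemma iter_partial_rcons (s : seq 'I_n) i (f : 'rV[R]_n -> W) :
  iter_partial (rcons s i) f = iter_partial s (partial i f).
Proof. by rewrite /iter_partial -cats1 foldr_cat. Qed.

(* [smooth] is the largest class of continuous functions with directional
   derivatives along the axes that is stable under [partial]. *)
Lemma smooth_coind (P : ('rV[R]_n -> W) -> Prop) :
  (forall g, P g -> continuous g /\
    forall i, (forall x, derivable g x (delta_mx ord0 i)) /\ P (partial i g)) ->
  forall f, P f -> smooth f.
Proof.
move=> hP f Pf s.
suff Ps : P (iter_partial s f).
  by have [c d] := hP _ Ps; split => // i x; exact: (d i).1.
elim: s => [//|i s IHs] /=; exact: ((hP _ IHs).2 i).2.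
Qed.

Lemma smooth_continuous (f : 'rV[R]_n -> W) : smooth f -> continuous f.
Proof. by move=> /(_ [::])[]. Qed.

Lemma smooth_derivable (f : 'rV[R]_n -> W) i x :
  smooth f -> derivable f x (delta_mx ord0 i).
Proof. by move=> /(_ [::])[_]; exact. Qed.

Lemma smooth_partial (f : 'rV[R]_n -> W) i : smooth f -> smooth (partial i f).
Proof. by move=> sf s; rewrite -iter_partial_rcons; exact: sf. Qed.

Lemma derive_translate (f : 'rV[R]_n -> W) (v x e : 'rV[R]_n) :
  'D_e (fun y => f (y + v)) x = 'D_e f (x + v).
Proof.
rewrite /derive; set g1 := fun h => h^-1 *: _; set g2 := fun h => h^-1 *: _.
suff -> : g1 = g2 by [].
by apply/funext => h; rewrite /g1 /g2 /= -addrA.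
Qed.

Lemma derivable_translate (f : 'rV[R]_n -> W) (v x e : 'rV[R]_n) :
  derivable f (x + v) e -> derivable (fun y => f (y + v)) x e.
Proof.
rewrite /derivable; set g1 := fun h => h^-1 *: _; set g2 := fun h => h^-1 *: _.
suff -> : g1 = g2 by [].
by apply/funext => h; rewrite /g1 /g2 /= -addrA.
Qed.

Lemma smooth_translate (f : 'rV[R]_n -> W) (v : 'rV[R]_n) :
  smooth f -> smooth (fun x => f (x + v)).
Proof.
move=> sf; pose P (g : 'rV[R]_n -> W) := exists2 h, smooth h & g = fun x => h (x + v).
apply: (smooth_coind (P := P)); last by exists f.
move=> _ [h sh ->]; split=> [x|i].
  apply: (@continuous_comp _ _ _ (fun x : 'rV[R]_n => x + v) h x).
    exact: translate_continuous.
  exact: (smooth_continuous sh).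
split=> [x|]; first by apply: derivable_translate; exact: smooth_derivable.
exists (partial i h); first exact: smooth_partial.
by apply/funext => x; rewrite /partial derive_translate.
Qed.

Lemma smooth_cst (c : W) : smooth (cst c : 'rV[R]_n -> W).
Proof.
apply: (smooth_coind (P := fun g => exists c, g = cst c)); last by exists c.
move=> _ [d ->]; split=> [|i]; first exact: cst_continuous.
split=> [x|]; first exact: derivable_cst.
by exists 0; apply/funext => x; rewrite /partial derive_cst.
Qed.

Lemma test_function_continuous (f : 'rV[R]_n -> W) :
  test_function f -> continuous f.
Proof. by move=> [/smooth_continuous]. Qed.

(** A compact K is closed here, so it contains the closure of the support as well. *)
Lemma compact_supportP (f : 'rV[R]_n -> W) (K : set 'rV[R]_n) :
  compact K -> (forall x, ~ K x -> f x = 0) ->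
  compact (closure [set x | f x != 0]).
Proof.
move=> cK f0; have clK : closed K by apply: compact_closed => //; exact: norm_hausdorff.
apply: subclosed_compact cK _; first exact: closed_closure.
rewrite [X in _ `<=` X](closure_id K).1//; apply: closure_subset => x /= fx.
by apply: contrapT => /f0 /eqP; rewrite (negbTE fx).
Qed.

Lemma support_nclosure (f : 'rV[R]_n -> W) x :
  ~ closure [set x | f x != 0] x -> \near x, f x = 0.
Proof.
move=> ncl; have : nbhs x (~` closure [set x | f x != 0]).
  by apply: open_nbhs_nbhs; split => //; exact/closed_openC/closed_closure.
apply: filterS => y ny; apply: contrapT => /eqP fy; apply: ny.
exact: subset_closure.
Qed.

Lemma test_function_partial (f : 'rV[R]_n -> W) i :
  test_function f -> test_function (partial i f).
Proof.
move=> [sf cf]; split; first exact: smooth_partial.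
apply: (compact_supportP cf) => x /support_nclosure fx0.
rewrite /partial -(derive_cst (0 : W) x (delta_mx ord0 i)).
exact: near_eq_derive.
Qed.

Lemma test_function_translate (f : 'rV[R]_n -> W) (v : 'rV[R]_n) :
  test_function f -> test_function (fun x => f (x + v)).
Proof.
move=> [sf cf]; split; first exact: smooth_translate.
apply: (@compact_supportP _ [set x | closure [set x | f x != 0] (x + v)]).
  rewrite (_ : [set x | _] = (fun y : 'rV[R]_n => y - v) @` closure [set x | f x != 0]).
    apply: continuous_compact cf; apply: continuous_subspaceT => x.
    exact: translate_continuous.
  apply/seteqP; split => [x /= h|_ [x h <-] /=]; last by rewrite subrK.
  by exists (x + v) => //; rewrite addrK.
by move=> x /= /support_nclosure /nbhs_singleton.
Qed.

Lemma test_function_bounded (f : 'rV[R]_n -> W) : test_function f ->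
  exists2 M : R, 0 <= M & forall x, `|f x| <= M.
Proof.
move=> [sf cf].
have : compact (f @` closure [set x | f x != 0]).
  by apply: continuous_compact cf; apply: continuous_subspaceT; exact: smooth_continuous.
move=> /compact_bounded[M [_ hM]].
(* The bound holds for every number above M, and M may be negative. *)
exists (`|M| + 1); first by rewrite addr_ge0.
move=> x; have [xK|/support_nclosure /nbhs_singleton ->] :=
  pselect (closure [set x | f x != 0] x); last by rewrite normr0 addr_ge0.
apply: (hM (`|M| + 1)); last by exists x.
by rewrite (le_lt_trans (ler_norm _))// ltrDl.
Qed.

End smooth_coinduction.

(** * Mean value estimates and products of smooth functions *)

Section line_derivative.
Context {R : realType} {n : nat}.
Implicit Types f : 'rV[R]_n -> R.

Lemma is_derive_line f (v x : 'rV[R]_n) (t : R) :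
  derivable f (t *: v + x) v ->
  is_derive t 1 (fun s : R => f (s *: v + x)) ('D_v f (t *: v + x)).
Proof.
move=> df.
have E : (fun h : R => h^-1 *: (((fun s : R => f (s *: v + x)) \o shift t)
      (h *: (1 : R)) - f (t *: v + x))) =
    (fun h : R => h^-1 *: ((f \o shift (t *: v + x)) (h *: v) - f (t *: v + x))).
  by apply/funext => h /=; rewrite scalerDl addrA [h *: 1]mulr1.
by split; rewrite /derivable /derive E.
Qed.

Lemma line_MVT f (v x : 'rV[R]_n) (t : R) : (forall y, derivable f y v) ->
  exists2 c : R, `|c| <= `|t| & f (t *: v + x) - f x = 'D_v f (c *: v + x) * t.
Proof.
move=> df; pose F (s : R) := f (s *: v + x).
have dF (s : R) : is_derive s 1 F ('D_v f (s *: v + x)) by exact: is_derive_line.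
have cF (a b : R) : {within `[a, b], continuous F}.
  by apply: derivable_within_continuous => s _; exact: (ex_derive (is_derive := dF s)).
have F0 : F 0 = f x by rewrite /F scale0r add0r.
rewrite -F0 -/(F t); have [t0|t0] := leP 0 t.
  have [c ct ->] := MVT_segment t0 (fun s _ => dF s) (cF _ _).
  exists c; last by rewrite subr0.
  by move: ct; rewrite in_itv/= => /andP[c0 ct]; rewrite !ger0_norm.
have [c ct E] := MVT_segment (ltW t0) (fun s _ => dF s) (cF _ _).
exists c; last by rewrite -opprB E; ring.
move: ct; rewrite in_itv/= => /andP[tc c0].
by rewrite ler0_norm// ltr0_norm// lerN2.
Qed.

(** Derivatives are known along the axes only, so one goes from x to h + x one coordinate at a time,
    with the mean value theorem on each leg; this produces the factor n. *)
Lemma partial_bounded_lipschitz f (M : R) : 0 <= M ->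
  (forall i x, derivable f x (delta_mx ord0 i)) ->
  (forall i x, `|partial i f x| <= M) ->
  forall x h, `|f (h + x) - f x| <= M * n%:R * `|h|.
Proof.
move=> M0 df fM x h.
have step i (t : R) y : `|f (t *: delta_mx ord0 i + y) - f y| <= M * `|t|.
  have [c _ ->] := line_MVT y t (df i).
  by rewrite normrM ler_wpM2r//; exact: fM.
(* Arbitrary lists of coordinates make the induction possible; the full list gives back h. *)
suff sum_step (s : seq 'I_n) :
    `|f (\sum_(i <- s) h ord0 i *: delta_mx ord0 i + x) - f x| <=
    \sum_(i <- s) M * `|h ord0 i|.
  rewrite {1}(row_sum_delta h); apply: (le_trans (sum_step _)).
  rewrite -mulr_sumr -mulrA.
  rewrite ler_wpM2l//.
  apply: (@le_trans _ _ (\sum_(i < n) `|h|)); first by apply: ler_sum => i _; exact: normrV_coord.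
  by rewrite sumr_const card_ord mulr_natl.
elim: s => [|i s IHs]; first by rewrite !big_nil add0r subrr normr0.
rewrite !big_cons -addrA; set y := _ + x in IHs *.
rewrite -[X in `|X|](subrKA (f y)).
by apply: le_trans (ler_normD _ _) _; rewrite lerD.
Qed.

Lemma test_function_lipschitz f : test_function f ->
  exists2 L : R, 0 <= L & forall x h, `|f (h + x) - f x| <= L * `|h|.
Proof.
move=> tf; have [sf _] := tf.
have /choice[M hM] : forall i : 'I_n, exists M : R, 0 <= M /\ forall x, `|partial i f x| <= M.
  by move=> i; have [M M0 hM] := test_function_bounded (test_function_partial i tf); exists M.
pose K := \sum_i M i.
have K0 : 0 <= K by apply: sumr_ge0 => i _; exact: (hM i).1.
exists (K * n%:R) => [|x h]; first by rewrite mulr_ge0.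
apply: partial_bounded_lipschitz => // i y; first exact: smooth_derivable.
apply: le_trans ((hM i).2 y) _; rewrite /K (bigD1 i)//= ler_wpDr//.
by apply: sumr_ge0 => j _; exact: (hM j).1.
Qed.

Lemma norm_delta_rV (i : 'I_n) : `|delta_mx ord0 i : 'rV[R]_n| <= 1.
Proof.
by apply/normrV_leP => // j; rewrite mxE eqxx/=; case: eqP; rewrite ?normr1 ?normr0.
Qed.

(** The mean value theorem moves the partial derivative by at most |t|, and that derivative is
    itself Lipschitz. Uniformity in x is what allows differentiating a mollification under the
    integral. *)
Lemma test_function_taylor1 f i : test_function f ->
  exists2 L : R, 0 <= L & forall x (t : R),
    `|f (t *: delta_mx ord0 i + x) - f x - t * partial i f x| <= L * t ^+ 2.
Proof.
move=> tf; have [sf _] := tf.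
have [L L0 hL] := test_function_lipschitz (test_function_partial i tf).
exists L => // x t.
have [c ct ->] := line_MVT x t (fun y => @smooth_derivable _ _ _ f i y sf).
rewrite [t * _]mulrC -mulrBl normrM -[t ^+ 2]real_normK ?num_real//.
rewrite expr2 mulrA ler_wpM2r//.
apply: le_trans (hL _ _) _; rewrite ler_wpM2l// normrZ.
by rewrite -[leRHS]mulr1 ler_pM// norm_delta_rV.
Qed.

(** Products alone are not stable under [partial]; by the Leibniz rule their finite sums are, as
    [smooth_coind] requires. *)
Inductive product_sum : ('rV[R]_n -> R) -> Prop :=
| product_sum_mul f g of smooth f & smooth g : product_sum (fun x => f x * g x)
| product_sum_add f g of product_sum f & product_sum g :
    product_sum (fun x => f x + g x).

Lemma smooth_product_sum f : product_sum f -> smooth f.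
Proof.
apply: smooth_coind => {}f; elim=> [g h sg sh|g h _ [cg IHg] _ [ch IHh]]; split.
- have cg : continuous g := smooth_continuous sg.
  have ch : continuous h := smooth_continuous sh.
  by move=> x; apply: (@continuousM R _ g h x); [exact: cg|exact: ch].
- move=> i; have dg x := smooth_derivable (i := i) (x := x) sg.
  have dh x := smooth_derivable (i := i) (x := x) sh.
  split=> [x|]; first exact: derivableM.
  have -> : partial i (fun x => g x * h x) =
      (fun x => g x * partial i h x + partial i g x * h x).
    apply/funext => x; rewrite /partial (deriveM (dg x) (dh x)).
    by rewrite ![_ *: _]mulrC [X in _ + X]mulrC mulrC [X in _ + X]mulrC.
  exact: (product_sum_add (product_sum_mul sg (smooth_partial i sh))
    (product_sum_mul (smooth_partial i sg) sh)).
- move=> x; exact: (cvgD (cg x) (ch x)).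
- move=> i; have [dg Pg] := IHg i; have [dh Ph] := IHh i.
  split=> [x|]; first exact: derivableD.
  have -> : partial i (fun x => g x + h x) =
      (fun x => partial i g x + partial i h x).
    by apply/funext => x; rewrite /partial (deriveD (dg x) (dh x)).
  exact: product_sum_add.
Qed.

Lemma smoothM f g : smooth f -> smooth g -> smooth (fun x => f x * g x).
Proof. by move=> sf sg; apply/smooth_product_sum/product_sum_mul. Qed.

Lemma smooth_prod (I : Type) (s : seq I) (F : I -> 'rV[R]_n -> R) :
  (forall i, smooth (F i)) -> smooth (fun x => \prod_(i <- s) F i x).
Proof.
move=> sF; elim: s => [|i s IHs].
  rewrite (_ : (fun x => _) = cst 1); first exact: smooth_cst.
  by apply/funext => x; rewrite big_nil.
rewrite (_ : (fun x => _) = (fun x => F i x * \prod_(j <- s) F j x)).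
  exact: (smoothM (sF i) IHs).
by apply/funext => x; rewrite big_cons.
Qed.

End line_derivative.

(** * Vector fields through their coordinates *)

Section vector_valued.
Context {R : realType} {n m : nat}.
Implicit Types phi : 'rV[R]_n -> 'rV[R]_m.

Lemma partial_coord phi i (j : 'I_m) :
  (forall x, derivable phi x (delta_mx ord0 i)) ->
  partial i (fun x => phi x ord0 j) = (fun x => partial i phi x ord0 j).
Proof.
by move=> dphi; apply/funext => x; rewrite /partial derive_mx// mxE.
Qed.

Lemma continuous_rVP phi :
  continuous phi <-> forall j, continuous (fun x => phi x ord0 j).
Proof.
split=> [cphi j x|cphi].
  apply: (@continuous_comp _ _ _ phi (fun v : 'rV[R]_m => v ord0 j) x).
    exact: cphi.
  exact: (@coord_continuous _ _ _ ord0 j).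
suff h (x : 'rV[R]_n) : phi y @[y --> x] --> phi x by [].
apply/(@cvgrPdist_le R _ _ (nbhs x) (nbhs_filter x)) => e e0.
have : \forall y \near x, forall j, `|phi x ord0 j - phi y ord0 j| <= e.
  apply: (@filter_forall _ _ _ (nbhs x) (nbhs_filter x)) => j.
  exact: ((@cvgrPdist_le R _ _ (nbhs x) (nbhs_filter x) _ _).1 (cphi j x) e e0).
by apply: filterS => y hy; apply/normrV_leP => [|j]; [exact: ltW|rewrite !mxE].
Qed.

Lemma smooth_rVP phi : smooth phi <-> forall j, smooth (fun x => phi x ord0 j).
Proof.
split=> [sphi j|sphi].
  pose P (g : 'rV[R]_n -> R) := exists2 psi : 'rV[R]_n -> 'rV[R]_m,
    smooth psi & g = (fun x => psi x ord0 j).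
  apply: (smooth_coind (P := P)); last by exists phi.
  move=> _ [psi spsi ->]; split.
    by have /continuous_rVP := smooth_continuous spsi; apply.
  move=> i; have dpsi x := smooth_derivable (i := i) (x := x) spsi.
  split=> [x|]; first by have /derivable_mxP := dpsi x; apply.
  by exists (partial i psi); [exact: smooth_partial|rewrite partial_coord].
pose P (psi : 'rV[R]_n -> 'rV[R]_m) := forall j, smooth (fun x => psi x ord0 j).
apply: (@smooth_coind _ _ _ P _ phi sphi) => psi Ppsi; split.
  by apply/continuous_rVP => j; exact: (smooth_continuous (Ppsi j)).
move=> i; have dpsi x : derivable psi x (delta_mx ord0 i).
  by apply/derivable_mxP => k j; rewrite (ord1 k); exact: (smooth_derivable (Ppsi j)).
split=> [x|j]; first exact: dpsi.
by have := smooth_partial i (Ppsi j); rewrite partial_coord.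
Qed.

Lemma smoothZ (f : 'rV[R]_n -> R) phi : smooth f -> smooth phi ->
  smooth (fun x => f x *: phi x).
Proof.
move=> sf /smooth_rVP sphi; apply/smooth_rVP => j.
rewrite (_ : (fun x => _) = (fun x => f x * phi x ord0 j)).
  exact: (smoothM sf (sphi j)).
by apply/funext => x; rewrite mxE.
Qed.

Lemma test_functionZ (f : 'rV[R]_n -> R) phi : smooth f -> test_function phi ->
  test_function (fun x => f x *: phi x).
Proof.
move=> sf [sphi cphi]; split; first exact: smoothZ.
apply: (compact_supportP cphi) => x /support_nclosure /nbhs_singleton ->.
exact: scaler0.
Qed.

Lemma test_function_coord phi j : test_function phi ->
  test_function (fun x => phi x ord0 j).
Proof.
move=> [/smooth_rVP sphi cphi]; split => //.
apply: (compact_supportP cphi) => x /support_nclosure /nbhs_singleton ->.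
by rewrite mxE.
Qed.

Lemma test_field_lipschitz phi : test_function phi ->
  exists2 L : R, 0 <= L & forall x h, `|phi (h + x) - phi x| <= L * `|h|.
Proof.
move=> tphi.
have /choice[L hL] : forall j : 'I_m, exists L : R, 0 <= L /\
    forall x h, `|phi (h + x) ord0 j - phi x ord0 j| <= L * `|h|.
  by move=> j; have [L L0 h] := test_function_lipschitz (test_function_coord j tphi); exists L.
have K0 : 0 <= \sum_j L j by apply: sumr_ge0 => j _; exact: (hL j).1.
exists (\sum_j L j) => // x h; apply/normrV_leP => [|j]; first by rewrite mulr_ge0.
rewrite !mxE; apply: le_trans ((hL j).2 x h) _; rewrite ler_wpM2r//.
rewrite (bigD1 j)//= ler_wpDr//.
by apply: sumr_ge0 => i _; exact: (hL i).1.
Qed.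

End vector_valued.

(** * Cutoff functions *)

Section flat_function.
Context {R : realType}.
Implicit Types (x u : R).

(* The span of these functions contains x |-> e^(-1/x) and is stable under
   differentiation. *)
Definition flat (k : nat) x : R :=
  if 0 < x then x^-1 ^+ k * expR (- x^-1) else 0.

Lemma flat_ge0 k x : 0 <= flat k x.
Proof.
rewrite /flat; case: ifP => // x0.
by rewrite mulr_ge0 ?expR_ge0// exprn_ge0// invr_ge0 ltW.
Qed.

(** With u = 1/x this is u^(k+2)/(k+2)! <= e^u. The quadratic bound makes [flat k] differentiable at
    0 with derivative 0. *)
Lemma flat_le k x : flat k x <= k.+2`!%:R * x ^+ 2.
Proof.
rewrite /flat; case: ifP => x0; last by rewrite mulr_ge0// sqr_ge0.
have u0 : 0 < x^-1 by rewrite invr_gt0.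
have f0 : (0 : R) < k.+2`!%:R by rewrite ltr0n fact_gt0.
rewrite expRN ler_pdivrMr ?expR_gt0// -mulrA mulrCA -ler_pdivrMl ?exprn_gt0//.
rewrite -exprVn -exprD add2n mulrC -ler_pdivrMr//.
by apply: le_trans (expR_ge1Dxn k.+1 (ltW u0)); rewrite ler_wpDl.
Qed.

Lemma is_derive_flat_gt0 k x : 0 < x ->
  is_derive x 1 (flat k) (flat k.+2 x - k%:R * flat k.+1 x).
Proof.
move=> x0; pose F := ((fun y => y^-1) ^+ k) * (expR \o (fun y : R => - y^-1)).
apply: (@near_eq_is_derive _ _ _ F).
  have : \forall y \near x, 0 < y by exact: lt_nbhsr.
  apply: filterS => y y0; by rewrite /flat y0 /F fctE exprfctE.
have xN0 : x != 0 by rewrite gt_eqF.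
have dV : is_derive x 1 (fun y : R => y^-1) (- x ^- 2).
  apply: is_derive_eq; first exact: (@is_deriveV _ id x 1 1 xN0 (is_derive_id _ _)).
  by rewrite [_ *: _]mulr1.
have dE : is_derive x 1 (expR \o (fun y : R => - y^-1)) (expR (- x^-1) * x ^- 2).
  apply: is_derive1_comp; apply: is_derive_eq; by rewrite opprK.
rewrite /F; apply: is_derive_eq.
rewrite /flat x0 exprfctE /= -!exprVn; set E := expR _; set y := x^-1.
rewrite /GRing.scale /=; case: k {F} => [|k]; first by rewrite !mul0r; ring.
by rewrite /= !exprS; ring.
Qed.

Lemma is_derive_flat k x :
  is_derive x 1 (flat k) (flat k.+2 x - k%:R * flat k.+1 x).
Proof.
have [x0|x0|->] := ltgtP x 0; last 2 first.
- exact: is_derive_flat_gt0.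
- rewrite /flat ltxx mulr0 subr0.
  have E : h^-1 *: ((flat k \o shift 0) (h *: (1 : R)) - flat k 0) @[h --> 0^'] --> (0 : R).
    apply/cvgr0Pnorm_le => e e0.
    pose C : R := k.+2`!%:R.
    have C0 : 0 < C by rewrite ltr0n fact_gt0.
    near=> h.
    have hN0 : h != 0 by near: h; exact: nbhs_dnbhs_neq.
    rewrite /= [h *: _]mulr1 addr0 {2}/flat ltxx subr0 normrZ normfV.
    rewrite ler_pdivrMl ?normr_gt0// ger0_norm ?flat_ge0//.
    apply: le_trans (flat_le _ _) _.
    rewrite -/C -real_normK ?num_real// expr2 mulrA mulrC ler_wpM2l//.
    rewrite -ler_pdivlMl//; near: h; apply: dnbhs0_le.
    by rewrite mulr_gt0// invr_gt0.
  by split; [apply/cvg_ex; exists 0|exact/cvg_lim].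
apply: (@near_eq_is_derive _ _ _ (cst 0)).
  have : \forall y \near x, y < 0 by exact: lt_nbhsl.
  by apply: filterS => y y0; rewrite /flat ltNge (ltW y0).
by rewrite /flat !ltNge (ltW x0)/= mulr0 subr0; exact: is_derive_cst.
Unshelve. all: by end_near. Qed.

Lemma continuous_flat k : continuous (flat k).
Proof.
by move=> x; apply: differentiable_continuous; apply/derivable1_diffP;
  exact: (ex_derive (is_derive := is_derive_flat k x)).
Qed.

End flat_function.

Section cutoff_function.
Context {R : realType} {n : nat}.
Implicit Types (x : 'rV[R]_n) (a s : R).

Lemma is_derive_flat_coord k a s (j i : 'I_n) x :
  is_derive x (delta_mx ord0 i) (fun x : 'rV[R]_n => flat k (a + s * x ord0 j))
    ((j == i)%:R * s * (flat k.+2 (a + s * x ord0 j)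
      - k%:R * flat k.+1 (a + s * x ord0 j))).
Proof.
set d := _ - _.
pose G (t : R) := flat k (a + s * (x ord0 j + t * (j == i)%:R)).
have E : (fun h : R => h^-1 *: (((fun x : 'rV[R]_n => flat k (a + s * x ord0 j)) \o
      shift x) (h *: delta_mx ord0 i) - flat k (a + s * x ord0 j))) =
    (fun h : R => h^-1 *: ((G \o shift 0) (h *: (1 : R)) - G 0)).
  by apply/funext => h /=; rewrite /G !mxE eqxx/= mul0r !addr0 [h *: 1]mulr1 [_ + x _ _]addrC.
suff : is_derive (0 : R) 1 G ((j == i)%:R * s * d).
  by move=> [dG DG]; split; rewrite /derivable /derive E.
have dl : is_derive (0 : R) 1 (fun t : R => a + s * (x ord0 j + t * (j == i)%:R)) (s * (j == i)%:R).
  apply: is_derive_eq; rewrite /GRing.scale /=; ring.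
rewrite mulrC; apply: is_derive_eq.
  apply: (@is_derive1_comp _ (flat k) _ 0 d _ _ dl).
  rewrite mul0r addr0; exact: is_derive_flat.
by rewrite [s * _]mulrC.
Qed.

(** A class stable under [partial]: by [is_derive_flat_coord], differentiating a generator gives a
    combination of generators with the same a, s and j. *)
Inductive flat_span : ('rV[R]_n -> R) -> Prop :=
| flat_span_coord k a s j : flat_span (fun x => flat k (a + s * x ord0 j))
| flat_span_scale c f of flat_span f : flat_span (fun x => c * f x)
| flat_span_add f g of flat_span f & flat_span g : flat_span (fun x => f x + g x).

Lemma smooth_flat_span f : flat_span f -> smooth f.
Proof.
apply: smooth_coind => {}f; elim=> [k a s j|c g _ [cg IHg]|g h _ [cg IHg] _ [ch IHh]]; split.
- move=> x; apply: (@continuous_comp _ _ _ (fun x : 'rV[R]_n => a + s * x ord0 j) (flat k) x).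
    apply: (@continuousD R _ _ (cst a) (fun x : 'rV[R]_n => s * x ord0 j) x).
      exact: cst_continuous.
    apply: (@continuousM R _ (cst s) (fun x : 'rV[R]_n => x ord0 j) x).
      exact: cst_continuous.
    exact: (@coord_continuous _ _ _ ord0 j).
  exact: continuous_flat.
- move=> i; split=> [x|]; first exact: (ex_derive (is_derive := is_derive_flat_coord k a s j i x)).
  have -> : partial i (fun x : 'rV[R]_n => flat k (a + s * x ord0 j)) =
      (fun x => (j == i)%:R * s * (flat k.+2 (a + s * x ord0 j) +
         (- k%:R) * flat k.+1 (a + s * x ord0 j))).
    apply/funext => x.
    rewrite /partial (derive_val (is_derive := is_derive_flat_coord k a s j i x)).
    by rewrite mulNr.
  apply: flat_span_scale; apply: flat_span_add; first exact: flat_span_coord.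
  by apply: flat_span_scale; exact: flat_span_coord.
- by move=> x; apply: (@continuousM R _ (cst c) g x); [exact: cst_continuous|exact: cg].
- move=> i; have [dg Pg] := IHg i; split=> [x|].
    exact: (derivableM (derivable_cst c x _) (dg x)).
  have -> : partial i (fun x => c * g x) = (fun x => c * partial i g x).
    apply/funext => x; rewrite /partial.
    rewrite (deriveM (derivable_cst c x _) (dg x)) derive_cst.
    by rewrite scaler0 addr0.
  exact: flat_span_scale.
- by move=> x; apply: (@continuousD R _ _ g h x); [exact: cg|exact: ch].
- move=> i; have [dg Pg] := IHg i; have [dh Ph] := IHh i.
  split=> [x|]; first exact: derivableD.
  have -> : partial i (fun x => g x + h x) =
      (fun x => partial i g x + partial i h x).
    by apply/funext => x; rewrite /partial (deriveD (dg x) (dh x)).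
  exact: flat_span_add.
Qed.

(* The factor e^2 gives cutoff s 0 = 1; the support is the cube `|x| <= s^-1. *)
Definition cutoff s x : R :=
  \prod_(j < n) (expR 2 * (flat 0 (1 + s * x ord0 j) * flat 0 (1 + - s * x ord0 j))).

Lemma smooth_cutoff s : smooth (cutoff s).
Proof.
apply: smooth_prod => j; apply: smoothM; first exact: smooth_cst.
by apply: smoothM; apply: smooth_flat_span; exact: flat_span_coord.
Qed.

Let factor (t : R) := expR 2 * (flat 0 (1 + t) * flat 0 (1 - t)).

Let factor_ge0 t : 0 <= factor t.
Proof. by rewrite mulr_ge0 ?expR_ge0// mulr_ge0 ?flat_ge0. Qed.

Let factor_le1 t : factor t <= 1.
Proof.
rewrite /factor /flat !expr0 !mul1r.
case: ifP => t1; last by rewrite mul0r mulr0.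
case: ifP => t2; last by rewrite !mulr0.
rewrite -!expRD -[leRHS]expR0 ler_expR.
have E : 2 + (- (1 + t)^-1 - (1 - t)^-1) = - 2 * t ^+ 2 * ((1 + t)^-1 * (1 - t)^-1).
  by field; apply/andP; split; rewrite gt_eqF.
rewrite E mulr_le0_ge0//; last by rewrite mulr_ge0// invr_ge0 ltW.
by rewrite mulNr oppr_le0 mulr_ge0// sqr_ge0.
Qed.

Let factor0 : factor 0 = 1.
Proof.
rewrite /factor /flat !(addr0, subr0) ltr01 !expr0 !mul1r invr1 -!expRD.
by rewrite -[RHS]expR0; congr expR; ring.
Qed.

Let cutoffE s x : cutoff s x = \prod_(j < n) factor (s * x ord0 j).
Proof. by apply: eq_bigr => j _; rewrite /factor mulNr. Qed.

Lemma cutoff_ge0 s x : 0 <= cutoff s x.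
Proof. by rewrite cutoffE; apply: prodr_ge0. Qed.

Lemma cutoff_le1 s x : cutoff s x <= 1.
Proof. by rewrite cutoffE; apply: prodr_ile1 => j _; rewrite factor_ge0 factor_le1. Qed.

Lemma cutoff0 s : cutoff s 0 = 1.
Proof. by rewrite cutoffE big1// => j _; rewrite mxE mulr0. Qed.

Lemma cutoff_scale s x : cutoff s x = cutoff 1 (s *: x).
Proof. by rewrite !cutoffE; apply: eq_bigr => j _; rewrite mxE mul1r. Qed.

Lemma cutoff_neq0 s x : 0 < s -> cutoff s x != 0 -> `|x| <= s^-1.
Proof.
move=> s0; rewrite cutoffE => /prodf_neq0 h.
apply/normrV_leP => [|j]; first by rewrite invr_ge0 ltW.
have := h j isT; rewrite /factor /flat.
case: ifP => t1; last by rewrite mul0r mulr0 eqxx.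
case: ifP => t2; last by rewrite !mulr0 eqxx.
move=> _; rewrite -[leRHS]mul1r ler_pdivlMr// -[X in _ * X]ger0_norm ?(ltW s0)//.
by rewrite -normrM mulrC ler_norml; apply/andP; split; lra.
Qed.

Lemma closed_cube (r : R) : closed [set x : 'rV[R]_n | `|x| <= r].
Proof.
apply: (@preimage_closed _ _ (fun x : 'rV[R]_n => `|x|) [set t : R | t <= r]).
  by move=> x _; exact: norm_continuous.
exact: closed_le.
Qed.

Lemma compact_cube (r : R) : compact [set x : 'rV[R]_n | `|x| <= r].
Proof.
apply: bounded_closed_compact; last exact: closed_cube.
exists r; split; first exact: num_real.
by move=> M rM x /= xr; rewrite (le_trans xr)// ltW.
Qed.

Lemma test_function_cutoff s : 0 < s -> test_function (cutoff s).
Proof.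
move=> s0; split; first exact: smooth_cutoff.
have := @compact_supportP R n R (cutoff s) [set x | `|x| <= s^-1].
apply; first exact: compact_cube.
by move=> x; apply: contra_notP => /eqP; exact: cutoff_neq0.
Qed.

(** [cutoff s] is [cutoff 1] after the dilation by s, so one L serves every scale; this gives the
    Lipschitz constants tending to 0. *)
Lemma cutoff_lipschitz : exists2 L : R, 0 <= L & forall s x y, 0 <= s ->
  `|cutoff s x - cutoff s y| <= L * s * `|x - y|.
Proof.
have [L L0 hL] := test_function_lipschitz (test_function_cutoff ltr01).
exists L => // s x y s0; rewrite !(cutoff_scale s).
rewrite -[s *: x](subrK (s *: y)); apply: le_trans (hL _ _) _.
by rewrite -scalerBr normrZ ger0_norm// mulrA.
Qed.

End cutoff_function.

(** * Mollification *)

Section mollification.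
Context {R : realType} {n : nat}.
Local Notation mu := (lebesgue_rV R n).
Implicit Types (f g rho : 'rV[R]_n -> R) (x y z : 'rV[R]_n).

(** Allows a derivative to be read off an estimate, so that no limit has to be exchanged with an
    integral. *)
Lemma quadratic_is_derive (F : 'rV[R]_n -> R) (x v : 'rV[R]_n) (D C : R) :
  (forall h : R, `|F (h *: v + x) - F x - h * D| <= C * h ^+ 2) ->
  is_derive x v F D.
Proof.
move=> hF.
have C0 : 0 <= C.
  by have := le_trans (normr_ge0 _) (hF 1); rewrite expr1n mulr1.
have E : h^-1 *: ((F \o shift x) (h *: v) - F x) @[h --> 0^'] --> D.
  apply/cvgrPdist_le => e e0; near=> h.
  have hN0 : h != 0 by near: h; exact: nbhs_dnbhs_neq.
  rewrite /= /GRing.scale /= distrC.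
  rewrite (_ : _ - D = h^-1 * (F (h *: v + x) - F x - h * D)); last by field.
  rewrite normrM normfV ler_pdivrMl ?normr_gt0//; apply: le_trans (hF h) _.
  rewrite -real_normK ?num_real// expr2 mulrA mulrC ler_wpM2l//.
  apply: (@le_trans _ _ ((C + 1) * `|h|)); first by rewrite ler_wpM2r// lerDl.
  rewrite -ler_pdivlMl ?ltr_wpDl//; near: h; apply: dnbhs0_le.
  by rewrite mulr_gt0// invr_gt0 ltr_wpDl.
by split; [apply/cvg_ex; exists D|exact/cvg_lim].
Unshelve. all: by end_near. Qed.

Lemma lipschitz_continuous_rV (F : 'rV[R]_n -> R) (C : R) :
  (forall x h, `|F (h + x) - F x| <= C * `|h|) -> continuous F.
Proof.
move=> hF; suff h (x : 'rV[R]_n) : F y @[y --> x] --> F x by [].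
apply/(@cvgrPdist_le R _ _ (nbhs x) (nbhs_filter x)) => e e0.
have C1 : 0 < `|C| + 1 by rewrite ltr_wpDl.
near=> y; rewrite distrC -[y](subrK x); apply: le_trans (hF _ _) _.
apply: (@le_trans _ _ ((`|C| + 1) * `|y - x|)).
  by rewrite ler_wpM2r// (le_trans (ler_norm _))// lerDl.
rewrite -ler_pdivlMl// distrC; near: y; apply: (@cvgr_dist_le _ _ _ (nbhs x)).
  exact: cvg_id.
by rewrite mulr_gt0// invr_gt0.
Unshelve. all: by end_near. Qed.

Lemma integrable_mul_bounded g (b : 'rV[R]_n -> R) (M : R) :
  mu.-integrable setT (EFin \o g) -> measurable_fun setT b ->
  (forall x, `|b x| <= M) -> mu.-integrable setT (EFin \o (fun x => g x * b x)).
Proof.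
move=> ig mb bM.
have M0 : 0 <= M by apply: le_trans (bM 0).
have mg : measurable_fun setT g by apply/measurable_EFinP; exact: measurable_int ig.
apply: (le_integrable measurableT _ _ (integrableZl measurableT M ig)).
  by apply/measurable_EFinP; exact: measurable_funM.
move=> x _ /=; rewrite lee_fin !normrM mulrC (ger0_norm M0).
by rewrite ler_wpM2r.
Qed.

Lemma Rintegral_mul_bounded_le g (b : 'rV[R]_n -> R) (M : R) :
  mu.-integrable setT (EFin \o g) -> measurable_fun setT b ->
  (forall x, `|b x| <= M) ->
  `|\int[mu]_x (g x * b x)| <= M * \int[mu]_x `|g x|.
Proof.
move=> ig mb bM; have igb := integrable_mul_bounded ig mb bM.
apply: (le_trans (le_normr_Rintegral measurableT igb)).
have ign := integrable_norm ig.
rewrite -RintegralZl//; apply: le_Rintegral => //.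
- exact: (integrable_norm igb).
- by have := integrableZl measurableT M ign; apply: eq_integrable.
- by move=> x _; rewrite normrM mulrC ler_wpM2r.
Qed.

(** The convolution of g with the reflected kernel z |-> rho(-z); this explains the minus sign in
    [mollify_is_derive]. *)
Definition mollify rho g x : R := \int[mu]_y (g y * rho (y - x)).

Section smooth_mollify.
Variable g : 'rV[R]_n -> R.
Hypothesis ig : mu.-integrable setT (EFin \o g).

Let measurable_shift rho x : test_function rho ->
  measurable_fun setT (fun y => rho (y - x)).
Proof.
move=> trho; apply: continuous_measurable_rV.
by apply: test_function_continuous; exact: (test_function_translate (- x) trho).
Qed.

Let integrable_shift rho x : test_function rho ->
  mu.-integrable setT (EFin \o (fun y => g y * rho (y - x))).
Proof.
move=> trho; have [M _ hM] := test_function_bounded trho.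
by apply: (integrable_mul_bounded ig (measurable_shift x trho) (M := M)).
Qed.

Lemma mollify_lipschitz rho : test_function rho ->
  exists C : R, forall x h, `|mollify rho g (h + x) - mollify rho g x| <= C * `|h|.
Proof.
move=> trho; have [L L0 hL] := test_function_lipschitz trho.
exists (L * \int[mu]_y `|g y|) => x h.
rewrite /mollify -RintegralB//; try exact: integrable_shift.
under eq_Rintegral do rewrite -mulrBr.
rewrite mulrAC; apply: Rintegral_mul_bounded_le => //.
  by apply: measurable_funB; exact: measurable_shift.
move=> y; have := hL (y - x) (- h).
by rewrite normrN (_ : - h + (y - x) = y - (h + x))// opprD addrCA addrA.
Qed.

(** The Taylor remainder of rho is at most L h^2 at every point, so integrated against g it is at
    most L ||g||_1 h^2. *)
Lemma mollify_is_derive rho i x : test_function rho ->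
  is_derive x (delta_mx ord0 i) (mollify rho g) (- mollify (partial i rho) g x).
Proof.
move=> trho; have [L L0 hL] := test_function_taylor1 i trho.
have tprho := test_function_partial i trho.
apply: (@quadratic_is_derive _ _ _ _ (L * \int[mu]_y `|g y|)) => h.
rewrite mulrN opprK /mollify -RintegralB//; try exact: integrable_shift.
rewrite -(RintegralZl h measurableT (integrable_shift x tprho)).
rewrite -RintegralD//; last 2 first.
- have := integrableB measurableT (integrable_shift (h *: delta_mx ord0 i + x) trho)
    (integrable_shift x trho).
  exact: eq_integrable.
- have := integrableZl measurableT h (integrable_shift x tprho).
  exact: eq_integrable.
rewrite (_ : \int[mu]_y _ = \int[mu]_y (g y * (rho (y - (h *: delta_mx ord0 i + x)) -
    rho (y - x) + h * partial i rho (y - x)))); last first.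
  by apply: eq_Rintegral => y _; ring.
rewrite mulrAC; apply: Rintegral_mul_bounded_le => //.
  apply: measurable_funD; first by apply: measurable_funB; exact: measurable_shift.
  by apply: measurable_funM => //; exact: measurable_shift.
move=> y; have := hL (y - x) (- h); rewrite sqrrN mulNr opprK scaleNr.
by rewrite (_ : - (h *: delta_mx ord0 i) + (y - x) = y - (h *: delta_mx ord0 i + x))//
  opprD addrCA addrA.
Qed.

Lemma smooth_mollify rho : test_function rho -> smooth (mollify rho g).
Proof.
move=> trho.
(* The scalar c absorbs the sign that each differentiation produces. *)
pose P (F : 'rV[R]_n -> R) := exists rho' c, test_function rho' /\
  F = (fun x => c * mollify rho' g x).
apply: (@smooth_coind _ _ _ P); last first.
  by exists rho, 1; split => //; apply/funext => x; rewrite mul1r.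
move=> _ [{trho}rho [c [trho ->]]].
have cm : continuous (mollify rho g).
  by have [C hC] := mollify_lipschitz trho; exact: (lipschitz_continuous_rV hC).
split; first by move=> x; apply: (@continuousM R _ (cst c) _ x); [exact: cst_continuous|exact: cm].
move=> i; have dm x := mollify_is_derive i x trho.
have dm' x := ex_derive (is_derive := dm x).
split=> [x|]; first exact: (derivableM (derivable_cst c x _) (dm' x)).
exists (partial i rho), (- c); split; first exact: test_function_partial.
apply/funext => x; rewrite /partial.
rewrite (deriveM (derivable_cst c x _) (dm' x)) derive_cst scaler0 addr0.
by rewrite (derive_val (is_derive := dm x)) /GRing.scale /= mulrN mulNr.
Qed.

Lemma mollify_eq0 rho (a b : R) x :
  (forall y, a < `|y| -> g y = 0) -> (forall z, b < `|z| -> rho z = 0) ->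
  a + b < `|x| -> mollify rho g x = 0.
Proof.
move=> ga rb abx; rewrite /mollify.
transitivity (\int[mu]_(y in setT) (0 : R)); last by rewrite Rintegral_cst// mul0r.
apply: eq_Rintegral => y _; have [ya|ya] := leP `|y| a; last by rewrite ga// mul0r.
  rewrite rb ?mulr0// ltNge; apply/negP => yxb.
have : `|x| <= a + b.
  rewrite -(subrKC y x); apply: le_trans (ler_normD _ _) _.
  by rewrite lerD// distrC.
by rewrite leNgt abx.
Qed.

Lemma test_function_mollify rho (a b : R) : test_function rho ->
  (forall y, a < `|y| -> g y = 0) -> (forall z, b < `|z| -> rho z = 0) ->
  test_function (mollify rho g).
Proof.
move=> trho ga rb; split; first exact: smooth_mollify.
have := @compact_supportP R n R (mollify rho g) [set x | `|x| <= a + b].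
apply; first exact: compact_cube.
by move=> x /= /negP; rewrite -ltNge; exact: mollify_eq0.
Qed.

Lemma mollify_translateE rho x : test_function rho ->
  mollify rho g x = \int[mu]_z (g (z + x) * rho z).
Proof.
move=> trho; rewrite /mollify -(Rintegral_translate x); last exact: integrable_shift.
by apply: eq_Rintegral => z _; rewrite addrK.
Qed.

End smooth_mollify.

(** A cutoff supported in the cube of radius d is divided by its integral I. Finiteness of I comes
    from the support, positivity from a lower bound 1/2 near the origin. *)
Lemma mollifier_exists (d : R) : 0 < d -> exists rho : 'rV[R]_n -> R,
  [/\ test_function rho, forall z, 0 <= rho z,
      forall z, d < `|z| -> rho z = 0 & (\int[mu]_z (rho z)%:E = 1)%E].
Proof.
move=> d0; have s0 : 0 < d^-1 by rewrite invr_gt0.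
have tb := @test_function_cutoff R n _ s0.
have mb : measurable_fun setT (@cutoff R n d^-1).
  by apply: continuous_measurable_rV; exact: test_function_continuous.
have [L L0 hL] := @cutoff_lipschitz R n.
(* For |z| <= r the Lipschitz bound lets the cutoff drop from its value 1 at 0 by at most 1/2; the
   summand 1 covers L = 0. *)
pose r : R := (2 * (L * d^-1 + 1))^-1.
have Ld : 0 <= L * d^-1 by rewrite mulr_ge0// ltW.
have r0 : 0 < r by rewrite invr_gt0 mulr_gt0// ltr_wpDl.
have bd z : d < `|z| -> cutoff d^-1 z = 0.
  move=> dz; apply/eqP; apply: contraTT dz => /(cutoff_neq0 s0).
  by rewrite invrK -leNgt.
pose I : \bar R := (\int[mu]_z (cutoff d^-1 z)%:E)%E.
have I0 : (0 < I)%E.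
  apply: (@lt_le_trans _ _ (\int[mu]_z (2^-1 * \1_[set z : 'rV[R]_n | (`|z| <= r)%R] z)%:E)%E).
    rewrite (@integral_cube_indic R n 2^-1 r _ (ltW r0)) ?invr_ge0//.
    rewrite lte_fin.
    by rewrite mulr_gt0 ?invr_gt0// exprn_gt0// mulr_gt0.
  apply: ge0_le_integral => //.
  - apply/measurable_EFinP; apply: measurable_funM => //.
    exact: measurable_indic (measurable_cube _).
  - by apply/measurable_EFinP.
  move=> z _; rewrite lee_fin indicE.
  have [zr|zr] := pselect (`|z| <= r); last by rewrite memNset// mulr0 cutoff_ge0.
  rewrite mem_set// mulr1.
  have := hL d^-1 z 0 (ltW s0); rewrite cutoff0 subr0 ler_norml => /andP[h _].
  have : L * d^-1 * `|z| <= 2^-1.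
    apply: (@le_trans _ _ ((L * d^-1 + 1) * r)).
      by rewrite ler_pM// lerDl.
    by rewrite /r invfM mulrCA mulfV ?mulr1// gt_eqF// ltr_wpDl.
  lra.
have Ifin : I \is a fin_num.
  rewrite ge0_fin_numE ?(ltW I0)//.
  apply: (@le_lt_trans _ _
    (\int[mu]_z (1 * \1_[set z : 'rV[R]_n | (`|z| <= d)%R] z)%:E)%E); last first.
    by rewrite integral_cube_indic ?(ltW d0)// ltry.
  apply: ge0_le_integral => //.
  - by move=> z _; rewrite lee_fin cutoff_ge0.
  - by apply/measurable_EFinP.
  - apply/measurable_EFinP; apply: measurable_funM => //.
    exact: measurable_indic (measurable_cube _).
  move=> z _; rewrite lee_fin mul1r indicE.
  have [zr|/negP] := pselect (`|z| <= d); first by rewrite mem_set// cutoff_le1.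
  by rewrite -ltNge => /bd ->; rewrite ler0n.
have c0 : 0 < (fine I)^-1 by rewrite invr_gt0 fine_gt0// I0 ltey_eq Ifin.
exists (fun z => (fine I)^-1 * cutoff d^-1 z); split.
- split.
    apply: (@smoothM R n (cst (fine I)^-1) (cutoff d^-1)); first exact: smooth_cst.
    exact: smooth_cutoff.
  have := @compact_supportP R n R (fun z => (fine I)^-1 * cutoff d^-1 z) [set x | `|x| <= d].
  apply; first exact: compact_cube.
  by move=> z /= /negP; rewrite -ltNge => /bd ->; rewrite mulr0.
- by move=> z; rewrite mulr_ge0 ?cutoff_ge0// ltW.
- by move=> z /bd ->; rewrite mulr0.
- under eq_integral do rewrite EFinM.
  rewrite ge0_integralZl_EFin//; last 3 first.
  + by move=> z _; rewrite lee_fin cutoff_ge0.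
  + by apply/measurable_EFinP.
  + exact: ltW.
  rewrite -/I -[in X in (_ * X)%E](fineK Ifin) -EFinM mulVf//.
  by rewrite gt_eqF// fine_gt0// I0 ltey_eq Ifin.
Qed.

(** Minkowski's inequality by way of Tonelli: the error is an average over z of g(.+z) - g, and only
    |z| <= d carries weight. *)
Lemma mollify_L1_le rho g (d e : R) : mu.-integrable setT (EFin \o g) ->
  test_function rho -> (forall z, 0 <= rho z) ->
  (forall z, d < `|z| -> rho z = 0) -> (\int[mu]_z (rho z)%:E = 1)%E ->
  (forall z, `|z| <= d -> (\int[mu]_x (`|g (x + z)%R - g x|)%:E <= e%:E)%E) ->
  (\int[mu]_x (`|mollify rho g x - g x|)%:E <= e%:E)%E.
Proof.
move=> ig trho rho0 rhod rho1 ge.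
have mg : measurable_fun setT g by apply/measurable_EFinP; exact: measurable_int ig.
have crho := test_function_continuous trho.
have mrho := continuous_measurable_rV crho.
have [M _ hM] := test_function_bounded trho.
have irho : mu.-integrable setT (EFin \o rho).
  apply/integrableP; split; first exact/measurable_EFinP.
  by under eq_integral do rewrite /= ger0_norm//; rewrite rho1 ltry.
pose k (p : 'rV[R]_n * 'rV[R]_n) := (`|g (p.1 + p.2)%R - g p.1| * rho p.2)%:E.
have mk : measurable_fun setT k.
  apply/measurable_EFinP/measurable_funM.
    apply: measurableT_comp => //; apply: measurable_funB.
      exact: (measurableT_comp mg (measurable_addrV measurable_fst measurable_snd)).
    exact: (measurableT_comp mg measurable_fst).
  exact: (measurableT_comp mrho measurable_snd).
have k0 p : (0 <= k p)%E by rewrite lee_fin mulr_ge0.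
apply: (@le_trans _ _ (\int[mu]_x \int[mu]_z k (x, z))%E).
  apply: ge0_le_integral => //.
  - apply/measurable_EFinP; apply: measurableT_comp => //; apply: measurable_funB => //.
    have [C hC] := mollify_lipschitz ig trho.
    exact: (continuous_measurable_rV (lipschitz_continuous_rV hC)).
  - exact: measurable_fun_fubini_tonelli_F.
  move=> x _.
  have igx : mu.-integrable setT (EFin \o (fun z => g (z + x) * rho z)).
    exact: (integrable_mul_bounded (integrable_translate x ig) mrho hM).
  have igc : mu.-integrable setT (EFin \o (fun z => g x * rho z)).
    by have := integrableZl measurableT (g x) irho; apply: eq_integrable.
  (* Since rho has mass 1, g(x) is the average of the constant g(x). *)
  have -> : mollify rho g x - g x = \int[mu]_z ((g (z + x) - g x) * rho z).
    rewrite (mollify_translateE ig)//.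
    rewrite -[X in _ - X]mulr1 -[1 in X in _ - X](_ : \int[mu]_z rho z = 1); last first.
      by rewrite /Rintegral rho1.
    rewrite -(RintegralZl (g x) measurableT irho) -RintegralB//.
    by apply: eq_Rintegral => z _; rewrite mulrBl.
  rewrite EFin_normr_Rintegral//; last first.
    have := integrableB measurableT igx igc; apply: eq_integrable => // z _ /=.
    by rewrite -EFinB mulrBl.
  apply: le_trans; first apply: le_abse_integral => //.
    apply/measurable_EFinP/measurable_funM => //; apply: measurable_funB => //.
    exact: (measurableT_comp mg (measurable_translate x)).
  rewrite le_eqVlt; apply/orP; left; apply/eqP; apply: eq_integral => z _ /=.
  by rewrite /k /= normrM (ger0_norm (rho0 z)) [x + z]addrC.
rewrite (fubini_tonelli k mk)//.
apply: (@le_trans _ _ (\int[mu]_z (e%:E * (rho z)%:E))%E); last first.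
  rewrite integralZl//; first by rewrite rho1 mule1.
apply: ge0_le_integral => //.
- by move=> z _; exact: integral_ge0.
- exact: measurable_fun_fubini_tonelli_G.
- by apply/measurable_EFinP; exact: measurable_funM.
move=> z _; rewrite /k /=; under eq_integral do rewrite mulrC EFinM.
rewrite ge0_integralZl_EFin//; last exact: measurable_translate_diff.
have [zd|dz] := leP `|z| d; last by rewrite rhod// mul0e mule0.
by rewrite muleC lee_wpmul2r ?lee_fin//; exact: ge.
Qed.

End mollification.

(** * The fractional divergence *)

Section euclidean_estimates.
Context {R : realType} {n : nat}.
Implicit Types u v w : 'rV[R]_n.

Lemma normrV_le_enorm v : `|v| <= enorm v.
Proof.
apply/normrV_leP => [|i]; first exact: sqrtr_ge0.
rewrite -sqrtr_sqr ler_wsqrtr// /dotrV (bigD1 i)//= -expr2 lerDl.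
by apply: sumr_ge0 => j _; rewrite -expr2 sqr_ge0.
Qed.

Lemma enormZ (c : R) v : enorm (c *: v) = `|c| * enorm v.
Proof.
rewrite /enorm /dotrV -sqrtr_sqr -sqrtrM ?sqr_ge0// mulr_sumr; congr Num.sqrt.
by apply: eq_bigr => i _; rewrite !mxE; ring.
Qed.

Lemma dotrV0l w : dotrV 0 w = 0.
Proof. by rewrite /dotrV big1// => i _; rewrite mxE mul0r. Qed.

Lemma dotrVZr (c : R) v w : dotrV v (c *: w) = c * dotrV v w.
Proof.
by rewrite /dotrV mulr_sumr; apply: eq_bigr => i _; rewrite mxE mulrCA.
Qed.

Lemma dotrVBr v w1 w2 : dotrV v (w1 - w2) = dotrV v w1 - dotrV v w2.
Proof.
rewrite /dotrV -sumrB; apply: eq_bigr => i _; by rewrite !mxE mulrBr.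
Qed.

Lemma normr_dotrV_le v w : `|dotrV v w| <= n%:R * (`|v| * `|w|).
Proof.
apply: le_trans (ler_norm_sum _ _ _) _.
apply: (@le_trans _ _ (\sum_(i < n) `|v| * `|w|)); last first.
  by rewrite sumr_const card_ord mulr_natl.
by apply: ler_sum => i _; rewrite normrM ler_pM// normrV_coord.
Qed.

Lemma measurable_dotrV d (T : measurableType d) (f g : T -> 'rV[R]_n) :
  measurable_fun setT f -> measurable_fun setT g ->
  measurable_fun setT (fun t => dotrV (f t) (g t)).
Proof.
move=> /measurable_fun_rVP mf /measurable_fun_rVP mg.
by apply: measurable_sum => i; exact: measurable_funM.
Qed.

Lemma measurable_enorm d (T : measurableType d) (f : T -> 'rV[R]_n) :
  measurable_fun setT f -> measurable_fun setT (fun t => enorm (f t)).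
Proof.
move=> mf; apply: (@measurableT_comp _ _ _ _ _ _ (@Num.sqrt R)); last exact: measurable_dotrV.
exact: (continuous_measurable_fun (@sqrt_continuous R)).
Qed.

Lemma continuous_measurable_rV2 (phi : 'rV[R]_n -> 'rV[R]_n) :
  continuous phi -> measurable_fun setT phi.
Proof.
move=> /continuous_rVP cphi; apply/measurable_fun_rVP => i.
exact: continuous_measurable_rV.
Qed.

End euclidean_estimates.

Section frac_div_estimates.
Context {R : realType} {n : nat}.
Variable alpha : R.
Hypothesis alpha01 : 0 < alpha < 1.
Local Notation mu := (lebesgue_rV R n).
Implicit Types (phi : 'rV[R]_n -> 'rV[R]_n) (x y v w : 'rV[R]_n).

Definition frac_weight v w : R := dotrV v w / enorm v `^ (n%:R + alpha + 1).

Lemma frac_divE phi x : frac_div alpha phi x =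
  mu_const n alpha * \int[mu]_y frac_weight (y - x) (phi y - phi x).
Proof. by []. Qed.

(** The scalar product is at most n|v||w| in sup norms. One factor |v| lowers the exponent by 1, and
    |v| <= [enorm v] compares the denominators. *)
Lemma frac_weight_le v w (M s : R) : `|w| <= M * Num.min 1 (s * `|v|) ->
  `|frac_weight v w| <= n%:R * M * frac_kernel alpha s v.
Proof.
have /andP[a0 a1] := alpha01.
move=> wM; rewrite /frac_weight /frac_kernel mulrA -[_ * M * _]mulrA.
have c0 : 0 <= n%:R + alpha by rewrite addr_ge0// ltW.
have [->|v0] := eqVneq v 0.
  rewrite dotrV0l mul0r normr0 normr0 mulr0 (_ : Num.min 1 0 = 0) ?mulr0 ?mul0r//.
  by rewrite min_r.
have nv0 : 0 < `|v| by rewrite normr_gt0.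
have ev0 : 0 < enorm v by rewrite (lt_le_trans nv0)// normrV_le_enorm.
rewrite normrM normfV [X in _ / X]ger0_norm ?powR_ge0//.
rewrite ler_pdivrMr ?powR_gt0//.
apply: (le_trans (normr_dotrV_le _ _)).
rewrite -!mulrA ler_wpM2l// mulrA mulrA.
rewrite mulrC; apply: (@le_trans _ _ ((M * Num.min 1 (s * `|v|)) * `|v|)).
  by rewrite ler_wpM2r.
have M0 : 0 <= M * Num.min 1 (s * `|v|) by apply: le_trans wM.
rewrite -[leRHS]mulrA ler_wpM2l// ler_pdivlMl ?powR_gt0//.
apply: (@le_trans _ _ (`|v| `^ (n%:R + alpha + 1))).
  rewrite [leRHS]powRD; last by rewrite normr_eq0 v0 implybT.
  by rewrite powRr1.
by rewrite ge0_ler_powR ?nnegrE ?sqrtr_ge0 ?addr_ge0// ?(ltW a0)// normrV_le_enorm.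
Qed.

Lemma test_field_diff_le phi : test_function phi -> exists M s : R,
  [/\ 0 <= M, 0 <= s & forall x y, `|phi y - phi x| <= M * Num.min 1 (s * `|y - x|)].
Proof.
move=> tphi; have [B B0 hB] := test_function_bounded tphi.
have [L L0 hL] := test_field_lipschitz tphi.
have M0 : 0 < 2 * B + 1 by rewrite ltr_wpDl// mulr_ge0.
(* 2B bounds the difference far away and L|y - x| nearby; adding 1 makes the divisor positive. *)
exists (2 * B + 1), (L / (2 * B + 1)); split; [exact: ltW|by rewrite divr_ge0// ltW|].
move=> x y; rewrite minr_pMr ?(ltW M0)// mulr1 le_min; apply/andP; split.
  apply: le_trans (ler_normB _ _) _.
  have := hB x; have := hB y; lra.
rewrite mulrA mulrCA mulfV ?gt_eqF// mulr1.
by have := hL x (y - x); rewrite subrK.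
Qed.

Lemma measurable_frac_weight d (T : measurableType d) (f g : T -> 'rV[R]_n) :
  measurable_fun setT f -> measurable_fun setT g ->
  measurable_fun setT (fun t => frac_weight (f t) (g t)).
Proof.
move=> mf mg; apply: measurable_funM; first exact: measurable_dotrV.
have -> : (fun t => (enorm (f t) `^ (n%:R + alpha + 1))^-1) =
    (fun r : R => r `^ (- (n%:R + alpha + 1))) \o (fun t => enorm (f t)).
  by apply/funext => t /=; rewrite powRN.
by apply: measurableT_comp; [exact: measurable_powR|exact: measurable_enorm].
Qed.

Lemma integrable_frac_kernel_shift (s c : R) x : 0 <= s ->
  mu.-integrable setT (EFin \o (fun y => c * frac_kernel alpha s (y - x))).
Proof.
move=> s0.
have := integrableZl measurableT c
  (integrable_translate (- x) (integrable_frac_kernel alpha01 s0)).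
exact: eq_integrable.
Qed.

Lemma integrable_frac_weight phi x : test_function phi ->
  mu.-integrable setT (EFin \o (fun y => frac_weight (y - x) (phi y - phi x))).
Proof.
move=> tphi; have [M [s [M0 s0 hM]]] := test_field_diff_le tphi.
have mphi := continuous_measurable_rV2 (test_function_continuous tphi).
apply: (le_integrable measurableT _ _
  (integrable_frac_kernel_shift (n%:R * M) x s0)).
  apply/measurable_EFinP; apply: measurable_frac_weight.
    exact: measurable_translate.
  exact: measurable_subrV.
move=> y _ /=; rewrite lee_fin [leRHS]ger0_norm; first exact: frac_weight_le.
by apply: mulr_ge0; [exact: mulr_ge0|exact: frac_kernel_ge0].
Qed.

Lemma Rintegral_kernel_shift (s : R) x : 0 <= s ->
  \int[mu]_y frac_kernel alpha s (y - x) = \int[mu]_h frac_kernel alpha s h.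
Proof.
by move=> s0; apply: (Rintegral_translate (- x)); exact: integrable_frac_kernel.
Qed.

(** At every x the integrand is dominated by a translate of the same kernel, whose integral does not
    depend on x. *)
Lemma frac_div_bounded phi : test_function phi ->
  exists B : R, forall x, `|frac_div alpha phi x| <= B.
Proof.
move=> tphi; have [M [s [M0 s0 hM]]] := test_field_diff_le tphi.
exists (`|mu_const n alpha| * (n%:R * M * \int[mu]_h frac_kernel alpha s h)) => x.
rewrite frac_divE normrM ler_wpM2l//.
have ix := integrable_frac_weight x tphi.
apply: (le_trans (le_normr_Rintegral measurableT ix)).
rewrite -(Rintegral_kernel_shift x s0) -RintegralZl//; last first.
  by have := integrable_frac_kernel_shift 1 x s0; apply: eq_integrable => // y _ /=; rewrite mul1r.
apply: le_Rintegral => //.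
- exact: (integrable_norm ix).
- exact: integrable_frac_kernel_shift.
- by move=> y _; exact: frac_weight_le.
Qed.

Lemma measurable_frac_div phi : test_function phi ->
  measurable_fun setT (frac_div alpha phi).
Proof.
move=> tphi; have mphi := continuous_measurable_rV2 (test_function_continuous tphi).
apply: measurable_funM => //.
pose G (p : 'rV[R]_n * 'rV[R]_n) :=
  (frac_weight (p.2 - p.1) (phi p.2 - phi p.1))%:E.
have mG : measurable_fun setT G.
  apply/measurable_EFinP/measurable_frac_weight.
    exact: (measurable_subrV measurable_snd measurable_fst).
  apply: measurable_subrV.
    exact: (measurableT_comp mphi measurable_snd).
  exact: (measurableT_comp mphi measurable_fst).
(* Tonelli gives measurability in x for nonnegative integrands, hence the split into positive and
   negative parts. *)
rewrite (_ : (fun x => _) = fine \o (fun x => \int[mu]_y G^\+ (x, y) - \int[mu]_y G^\- (x, y))%E).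
  apply: measurableT_comp; first exact: fine_measurable.
  apply: emeasurable_funB; apply: measurable_fun_fubini_tonelli_F => //.
  - exact: measurable_funepos.
  - exact: measurable_funeneg.
apply/funext => x; rewrite /Rintegral integralE.
by congr (fine (_ - _)%E); apply: eq_integral => y _; rewrite !unlock.
Qed.

Lemma frac_div_translate phi v x : test_function phi ->
  frac_div alpha (fun y => phi (y + v)) x = frac_div alpha phi (x + v).
Proof.
move=> tphi; rewrite (frac_divE _ x) (frac_divE phi (x + v)).
set I1 := (X in _ * X = _); set I2 := (X in _ = _ * X).
suff -> : I1 = I2 by reflexivity.
rewrite /I1 /I2.
apply: (etrans _ (Rintegral_translate v (integrable_frac_weight (x + v) tphi))).
by apply: eq_Rintegral => y _; rewrite opprD addrACA subrr addr0.
Qed.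

Lemma frac_divZ_diff_le (eta : 'rV[R]_n -> R) phi (s : R) x : 0 <= s ->
  smooth eta ->
  (forall x y, `|eta x - eta y| <= Num.min 1 (s * `|x - y|)) ->
  test_function phi -> {ae mu, forall y, `|phi y| <= 1} ->
  `|eta x * frac_div alpha phi x - frac_div alpha (fun y => eta y *: phi y) x| <=
  `|mu_const n alpha| * (n%:R * \int[mu]_h frac_kernel alpha s h).
Proof.
move=> s0 seta heta tphi phi1; have tep := test_functionZ seta tphi.
have i1 := integrable_frac_weight x tphi.
have i2 := integrable_frac_weight x tep.
have meta := continuous_measurable_rV (smooth_continuous seta).
have mphi := continuous_measurable_rV2 (test_function_continuous tphi).
(* In the difference of the two divergences the terms with phi(x) cancel, so only the size of phi
   matters and no longer its increments. *)
pose H y := frac_weight (y - x) ((eta x - eta y) *: phi y).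
have HE y : eta x * frac_weight (y - x) (phi y - phi x) -
    frac_weight (y - x) (eta y *: phi y - eta x *: phi x) = H y.
  by rewrite /H /frac_weight !dotrVBr !dotrVZr; ring.
rewrite !frac_divE mulrCA -mulrBr normrM ler_wpM2l//.
rewrite -RintegralZl// -RintegralB//; last first.
  by have := integrableZl measurableT (eta x) i1; apply: eq_integrable.
rewrite (_ : \int[mu]_y _ = \int[mu]_y H y); last first.
  by apply: eq_Rintegral => y _; exact: HE.
have iH : mu.-integrable setT (EFin \o H).
  have := integrableB measurableT (integrableZl measurableT (eta x) i1) i2.
  by apply: eq_integrable => // y _ /=; rewrite -HE.
apply: (le_trans (le_normr_Rintegral measurableT iH)).
rewrite -(Rintegral_kernel_shift x s0) -RintegralZl//; last first.
  by have := integrable_frac_kernel_shift 1 x s0; apply: eq_integrable => // y _ /=; rewrite mul1r.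
apply: fine_le.
- by apply: integrable_fin_num => //; exact: (integrable_norm iH).
- by apply: integrable_fin_num => //; exact: integrable_frac_kernel_shift.
(* The bound on phi is known only almost everywhere, so the integrands are compared almost
   everywhere. *)
apply: ae_ge0_le_integral => //.
- exact: measurable_int (integrable_norm iH).
- by move=> y _; rewrite lee_fin mulr_ge0 ?frac_kernel_ge0.
- exact: measurable_int (integrable_frac_kernel_shift n%:R x s0).
apply: filterS phi1 => y phiy _; rewrite lee_fin.
rewrite -[n%:R]mulr1; apply: frac_weight_le; rewrite mul1r normrZ.
by rewrite -[leRHS]mulr1 ler_pM// distrC.
Qed.

(** For [unit_test_fieldP]: on a space of positive measure the L^oo norm is the essential
    supremum. *)
Lemma lebesgue_rV_setT_gt0 : (0 < mu setT)%E.
Proof.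
apply: (@lt_le_trans _ _ (mu [set h | `|h| <= 1])).
  by rewrite lebesgue_rV_cube// lte_fin exprn_gt0.
by apply: le_measure; rewrite ?inE//; exact: measurable_cube.
Qed.

Lemma unit_test_fieldP phi : unit_test_field phi <->
  test_function phi /\ {ae mu, forall x, enorm (phi x) <= 1}.
Proof.
rewrite /unit_test_field unlock /= lebesgue_rV_setT_gt0.
split => -[tphi h]; split => //.
  move/ess_supP : h; apply: filterS => x /=.
  by rewrite lee_fin ger0_norm// sqrtr_ge0.
apply/ess_supP; apply: filterS h => x hx /=.
by rewrite lee_fin ger0_norm// sqrtr_ge0.
Qed.

Lemma unit_test_field_translate phi v : unit_test_field phi ->
  unit_test_field (fun x => phi (x + v)).
Proof.
move=> /unit_test_fieldP[tphi h]; apply/unit_test_fieldP; split.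
  exact: test_function_translate.
exact: (ae_translate v h).
Qed.

Lemma unit_test_fieldZ (eta : 'rV[R]_n -> R) phi : smooth eta ->
  (forall x, `|eta x| <= 1) -> unit_test_field phi ->
  unit_test_field (fun x => eta x *: phi x).
Proof.
move=> seta eta1 /unit_test_fieldP[tphi h]; apply/unit_test_fieldP; split.
  exact: test_functionZ.
apply: filterS h => x hx; rewrite enormZ -[leRHS]mulr1.
by rewrite ler_pM// sqrtr_ge0.
Qed.

End frac_div_estimates.

Lemma cvge_near (R : realType) (u : nat -> \bar R) (l : R) :
  (forall e : R, 0 < e -> \forall k \near \oo,
     ((l - e)%:E <= u k)%E /\ (u k <= (l + e)%:E)%E) ->
  u @ \oo --> l%:E.
Proof.
move=> ul; apply/fine_cvgP; split.
  have := ul 1 ltr01; apply: filterS => k [h1 h2].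
  by rewrite fin_numElt (lt_le_trans (ltNyr _) h1) (le_lt_trans h2 (ltry _)).
apply/cvgrPdist_le => e e0; have := ul e e0; apply: filterS => k [h1 h2] /=.
have uk : u k \is a fin_num.
  by rewrite fin_numElt (lt_le_trans (ltNyr _) h1) (le_lt_trans h2 (ltry _)).
rewrite -(fineK uk) !lee_fin in h1 h2.
by rewrite ler_norml; apply/andP; split; lra.
Qed.

(** * The fractional variation *)

Section variation_estimates.
Context {R : realType} {n : nat}.
Variable alpha : R.
Hypothesis alpha01 : 0 < alpha < 1.
Local Notation mu := (lebesgue_rV R n).
Local Notation V := (frac_variation alpha).
Implicit Types (f g rho : 'rV[R]_n -> R) (phi : 'rV[R]_n -> 'rV[R]_n).

Lemma integrable_frac_pairing f phi : mu.-integrable setT (EFin \o f) ->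
  test_function phi ->
  mu.-integrable setT (EFin \o (fun x => f x * frac_div alpha phi x)).
Proof.
move=> intf tphi; have [B hB] := frac_div_bounded alpha01 tphi.
exact: (integrable_mul_bounded intf (measurable_frac_div alpha tphi) hB).
Qed.

Lemma frac_pairingE f phi : mu.-integrable setT (EFin \o f) ->
  test_function phi ->
  (\int[mu]_x (f x * frac_div alpha phi x)%:E =
   (\int[mu]_x (f x * frac_div alpha phi x)%R)%:E)%E.
Proof.
move=> intf tphi; rewrite /Rintegral fineK//.
exact: (integrable_fin_num measurableT (integrable_frac_pairing intf tphi)).
Qed.

Lemma frac_pairing_le f phi : mu.-integrable setT (EFin \o f) ->
  unit_test_field phi ->
  ((\int[mu]_x (f x * frac_div alpha phi x)%R)%:E <= V f)%E.
Proof.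
move=> intf uphi; have [tphi _] := uphi; rewrite -frac_pairingE//.
by apply: ereal_sup_ubound; exists phi.
Qed.

Lemma unit_test_field0 : unit_test_field (cst 0 : 'rV[R]_n -> 'rV[R]_n).
Proof.
apply/unit_test_fieldP; split.
  split; first exact: smooth_cst.
  have := @compact_supportP R n 'rV[R]_n (cst 0) set0.
  by apply; [exact: compact0|].
by apply: aeW => x; rewrite /enorm /= dotrV0l sqrtr0.
Qed.

Lemma frac_variation_gtNy f : mu.-integrable setT (EFin \o f) -> (-oo < V f)%E.
Proof.
move=> intf; apply: lt_le_trans (frac_pairing_le intf unit_test_field0).
exact: ltNyr.
Qed.

Lemma frac_variation_cutoff_le (s L : R) f : 0 <= s -> 0 <= L ->
  (forall x y : 'rV[R]_n, `|cutoff s x - cutoff s y| <= L * s * `|x - y|) ->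
  mu.-integrable setT (EFin \o f) ->
  (V (fun x => f x * cutoff s x)%R <= V f +
    (`|mu_const n alpha| *
       (n%:R * \int[mu]_h frac_kernel alpha (L * s) h) *
     \int[mu]_x `|f x|)%:E)%E.
Proof.
move=> s0 L0 hL intf.
set C := `|_| * _.
have sc := @smooth_cutoff R n s.
have mc := continuous_measurable_rV (smooth_continuous sc).
have c1 x : `|@cutoff R n s x| <= 1 by rewrite ger0_norm ?cutoff_ge0 ?cutoff_le1.
have intcf := integrable_mul_bounded intf mc c1.
have hmin (x y : 'rV[R]_n) :
    `|cutoff s x - cutoff s y| <= Num.min 1 (L * s * `|x - y|).
  rewrite le_min hL andbT ler_norml.
  have := cutoff_ge0 s x; have := cutoff_ge0 s y.
  have := cutoff_le1 s x; have := cutoff_le1 s y.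
  by move=> h1 h2 h3 h4; apply/andP; split; lra.
apply: ge_ereal_sup => _ [phi uphi <-].
have [tphi phi1] := (unit_test_fieldP phi).1 uphi.
have ucphi := unit_test_fieldZ sc c1 uphi; have [tcphi _] := ucphi.
rewrite (frac_pairingE intcf tphi).
(* The commutator. The remaining term pairs f with the divergence of [cutoff s] times phi, again an
   admissible field because the cutoff lies in [0, 1]. *)
pose E x := cutoff s x * frac_div alpha phi x -
  frac_div alpha (fun y => cutoff s y *: phi y) x.
have mE : measurable_fun setT E.
  apply: measurable_funB; last exact: measurable_frac_div.
  by apply: measurable_funM => //; exact: measurable_frac_div.
have hE x : `|E x| <= C.
  apply: frac_divZ_diff_le => //; first by rewrite mulr_ge0.
  apply: filterS phi1 => y; apply: le_trans; exact: normrV_le_enorm.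
have -> : \int[mu]_x (f x * cutoff s x * frac_div alpha phi x) =
    \int[mu]_x (f x * frac_div alpha (fun y => cutoff s y *: phi y) x) +
    \int[mu]_x (f x * E x).
  rewrite -RintegralD//; last 2 first.
  - exact: integrable_frac_pairing.
  - exact: (integrable_mul_bounded intf mE hE).
  by apply: eq_Rintegral => x _; rewrite /E; ring.
rewrite EFinD leeD//; first exact: frac_pairing_le.
rewrite lee_fin; apply: le_trans (ler_norm _) _.
exact: Rintegral_mul_bounded_le.
Qed.

(* mollify rho g is an average of translates of g, with weight rho z. *)
Lemma frac_variation_mollify_le rho g : mu.-integrable setT (EFin \o g) ->
  test_function rho -> (forall z, 0 <= rho z) ->
  (\int[mu]_z (rho z)%:E = 1)%E ->
  (V (mollify rho g) <= V g)%E.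
Proof.
move=> ig trho rho0 rho1.
have [->|Vfin] := eqVneq (V g) +oo%E; first exact: leey.
have {}Vfin : V g \is a fin_num.
  by rewrite fin_numE Vfin andbT gt_eqF// frac_variation_gtNy.
have mg : measurable_fun setT g by apply/measurable_EFinP; exact: measurable_int ig.
have mrho := continuous_measurable_rV (test_function_continuous trho).
have irho : mu.-integrable setT (EFin \o rho).
  apply/integrableP; split; first exact/measurable_EFinP.
  by under eq_integral do rewrite /= ger0_norm//; rewrite rho1 ltry.
have [M _ hM] := test_function_bounded trho.
apply: ge_ereal_sup => _ [phi uphi <-].
have [tphi _] := uphi.
have [B hB] := frac_div_bounded alpha01 tphi.
have mD := measurable_frac_div alpha tphi.
pose F (p : 'rV[R]_n * 'rV[R]_n) : \bar R :=
  (g (p.2 + p.1) * rho p.2 * frac_div alpha phi p.1)%:E.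
have mF : measurable_fun setT F.
  apply/measurable_EFinP/measurable_funM.
    apply: measurable_funM.
      exact: (measurableT_comp mg (measurable_addrV measurable_snd measurable_fst)).
    exact: (measurableT_comp mrho measurable_snd).
  exact: (measurableT_comp mD measurable_fst).
have igz z : mu.-integrable setT (EFin \o (fun x => g (z + x))).
  have := integrable_translate z ig; apply: eq_integrable => // x _ /=.
  by rewrite addrC.
have igDz z := integrable_mul_bounded (igz z) mD hB.
have inner z : (\int[mu]_x F (x, z) =
    (rho z)%:E * (\int[mu]_x (g (z + x)%R * frac_div alpha phi x)%R)%:E)%E.
  rewrite /Rintegral fineK; last exact: (integrable_fin_num measurableT (igDz z)).
  rewrite -(integralZl measurableT (igDz z)).
  by apply: eq_integral => x _; rewrite /F /= -EFinM; congr EFin; ring.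
(* A translation of g is moved onto phi, and phi(. - z) is still admissible, so each translate of g
   obeys the bound for g. *)
have inner_le z : (\int[mu]_x (g (z + x)%R * frac_div alpha phi x)%R <= fine (V g))%R.
  rewrite -lee_fin (fineK Vfin).
  have uz := unit_test_field_translate (- z) uphi; have [tz _] := uz.
  apply: le_trans (frac_pairing_le ig uz).
  rewrite lee_fin le_eqVlt; apply/orP; left; apply/eqP.
  rewrite -[RHS](Rintegral_translate z (integrable_frac_pairing ig tz)).
  apply: eq_Rintegral => x _; rewrite [z + x]addrC.
  have E : frac_div alpha (fun y => phi (y - z)) (x + z) = frac_div alpha phi x.
    apply: (etrans (frac_div_translate alpha01 (- z) (x + z) tphi)).
    by rewrite addrK.
  by rewrite [in RHS]E.
(* Absolute integrability for Fubini: integrating |F| over x first gives at most B ||g||_1 rho(z),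
   by translation invariance, and rho has mass 1. *)
have iF : (mu \x mu)%E.-integrable setT F.
  apply: (integrable21ltyP mu mu mF).2.
  have ign := integrable_norm ig.
  pose K := B * \int[mu]_x `|g x|.
  apply: (@le_lt_trans _ _ (\int[mu]_z (K%:E * (rho z)%:E))%E); last first.
    by rewrite integralZl// rho1 mule1 ltry.
  have B0 : 0 <= B by apply: le_trans (hB 0).
  apply: ge0_le_integral => //.
  - by move=> z _; exact: integral_ge0.
  - apply: (measurable_fun_fubini_tonelli_G (abse \o F)).
      exact: measurableT_comp.
    by move=> p /=.
  - by apply/measurable_EFinP; exact: measurable_funM.
  move=> z _.
  apply: (@le_trans _ _ (\int[mu]_x ((B * rho z)%:E * (`|g (x + z)|)%:E))%E).
    apply: ge0_le_integral => //.
    - exact: (measurableT_comp _ (measurable_fun_pair1 z mF)).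
    - apply/measurable_EFinP; apply: measurable_funM => //; apply: measurableT_comp => //.
      exact: (measurableT_comp mg (measurable_translate z)).
    move=> x _; rewrite /F /= lee_fin; have := hB x.
    move: (frac_div alpha phi x) => D hD.
    rewrite !normrM (ger0_norm (rho0 z)) [z + x]addrC.
    rewrite mulrC mulrA mulrAC; apply: ler_wpM2r => //.
    by rewrite ler_wpM2r.
  rewrite ge0_integralZl_EFin//; last 2 first.
  - apply/measurable_EFinP; apply: measurableT_comp => //.
    exact: (measurableT_comp mg (measurable_translate z)).
  - by rewrite mulr_ge0.
  rewrite (ge0_integral_translate z (f := fun x => (`|g x|)%:E))//; last first.
    by apply/measurable_EFinP; exact: measurableT_comp.
  rewrite le_eqVlt; apply/orP; left; apply/eqP.
  rewrite -[X in (_ * X)%E]fineK; last exact: (integrable_fin_num measurableT ign).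
  by rewrite -!EFinM; congr EFin; rewrite /K /Rintegral; ring.
apply: (@le_trans _ _ (\int[mu]_x \int[mu]_z F (x, z))%E).
  rewrite le_eqVlt; apply/orP; left; apply/eqP; apply: eq_integral => x _.
  rewrite (mollify_translateE ig)//.
  have igx : mu.-integrable setT (EFin \o (fun z => g (z + x) * rho z)).
    exact: (integrable_mul_bounded (integrable_translate x ig) mrho hM).
  rewrite mulrC EFinM /Rintegral fineK; last exact: (integrable_fin_num measurableT igx).
  rewrite -(integralZl measurableT igx).
  by apply: eq_integral => z _; rewrite /F /= -EFinM mulrC.
rewrite (Fubini iF).
apply: (@le_trans _ _ (\int[mu]_z ((fine (V g))%:E * (rho z)%:E))%E).
  apply: (le_integral measurableT) => //.
  - apply: (le_integrable measurableT _ _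
      (integrableZl measurableT (B * \int[mu]_x `|g x|) irho)).
      exact: (measurable_fubini_G iF).
    have In0 : 0 <= \int[mu]_x `|g x| by apply: Rintegral_ge0.
    move=> z _; rewrite inner /= lee_fin normrM (ger0_norm (rho0 z)).
    rewrite mulrC [leRHS]ger0_norm; last first.
      by rewrite !mulr_ge0// (le_trans _ (hB 0)).
    rewrite ler_wpM2r//; apply: le_trans (Rintegral_mul_bounded_le (igz z) mD hB) _.
    rewrite -(Rintegral_translate z (integrable_norm ig)).
    by rewrite le_eqVlt; apply/orP; left; apply/eqP; congr (_ * _);
      apply: eq_Rintegral => x _; rewrite [x + z]addrC.
  - exact: integrableZl.
  by move=> z _; rewrite inner muleC -!EFinM lee_fin ler_wpM2r.
by rewrite integralZl// rho1 mule1 fineK.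
Qed.

End variation_estimates.

(** * Convergence of the cutoffs and the approximating sequence *)

Section approximation.
Context {R : realType} {n : nat}.
Local Notation mu := (lebesgue_rV R n).
Implicit Types (f g : 'rV[R]_n -> R).

(** Dominated convergence with majorant |f|: the cutoff is 1 at 0, hence at x it differs from 1 by
    at most L|x|/(k+1). *)
Lemma cvg_L1_cutoff f : mu.-integrable setT (EFin \o f) ->
  (\int[mu]_x (`|f x * cutoff k.+1%:R^-1 x - f x|)%:E)%E @[k --> \oo] --> 0%E.
Proof.
move=> intf.
have mf : measurable_fun setT f by apply/measurable_EFinP; exact: measurable_int intf.
have mc s := continuous_measurable_rV (smooth_continuous (@smooth_cutoff R n s)).
have [L L0 hL] := @cutoff_lipschitz R n.
have [] := @dominated_convergence _ _ _ mu _ measurableT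
  (fun k x => (f x * cutoff k.+1%:R^-1 x)%:E) (EFin \o f) (abse \o (EFin \o f)) _ _ _ _ _.
- by move=> k; apply/measurable_EFinP; exact: measurable_funM.
- exact: measurable_int intf.
- apply: aeW => x _; apply/fine_cvgP; split; first exact: nearW.
  rewrite -[X in _ --> X](mulr1 (f x)) /=; apply: cvgMr.
  apply: (@squeeze_cvgr _ _ _ _ (fun k => 1 - L * `|x : 'rV[R]_n| * k.+1%:R^-1) (cst 1)).
  + apply: nearW => k; rewrite /= cutoff_le1 andbT lerBlDr -lerBlDl.
    have := hL k.+1%:R^-1 0 x; rewrite invr_ge0 ler0n cutoff0 sub0r normrN => /(_ isT).
    by rewrite mulrAC; apply: le_trans; exact: ler_norm.
  + rewrite -[X in _ --> X]subr0; apply: cvgB; first exact: cvg_cst.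
    rewrite -[X in _ --> X](mulr0 (L * `|x : 'rV[R]_n|)); apply: cvgMr.
    exact: cvg_harmonic.
  + exact: cvg_cst.
- exact: integrable_abse.
- apply: aeW => x k _ /=; rewrite lee_fin normrM ler_piMr//.
  by rewrite ger0_norm ?cutoff_ge0 ?cutoff_le1.
by move=> _ h _.
Qed.

Lemma integrable_L1_diff f g : mu.-integrable setT (EFin \o g) ->
  measurable_fun setT f -> (\int[mu]_x (`|f x - g x|)%:E < +oo)%E ->
  mu.-integrable setT (EFin \o f).
Proof.
move=> ig mf fg.
have mg : measurable_fun setT g by apply/measurable_EFinP; exact: measurable_int ig.
have ifg : mu.-integrable setT (EFin \o (fun x => f x - g x)).
  apply/integrableP; split => //.
  by apply/measurable_EFinP; exact: measurable_funB.
have := integrableD measurableT ifg ig; apply: eq_integrable => // x _ /=.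
by rewrite -EFinD subrK.
Qed.

End approximation.

Theorem theorem3p8 (R : realType) (n : nat) (n1 : (1 <= n)%N)
    (alpha : R) (alpha01 : 0 < alpha < 1)
    (f : 'rV[R]_n -> R) (fBV : BV_frac alpha f) :
  exists f_ : nat -> 'rV[R]_n -> R,
    [/\ forall k, test_function (f_ k),
        ('N[lebesgue_rV R n]_1[EFin \o (f_ k \- f)%R])%E @[k --> \oo]
          --> 0%E
      & frac_variation alpha (f_ k) @[k --> \oo] --> frac_variation alpha f].
Proof.
have [intf Vlty] := fBV.
pose mu := lebesgue_rV R n.
have mf : measurable_fun setT f by apply/measurable_EFinP; exact: measurable_int intf.
have Vfin : frac_variation alpha f \is a fin_num.
  by rewrite fin_numElt Vlty frac_variation_gtNy.
have [L L0 hL] := @cutoff_lipschitz R n.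
(* Serves both as the cutoff scale and as the L^1 tolerance for the mollification. *)
pose s_ k : R := k.+1%:R^-1.
have s0 k : 0 < s_ k by rewrite invr_gt0.
pose g k x := f x * cutoff (s_ k) x.
have mg k : measurable_fun setT (g k).
  apply: measurable_funM => //; apply: continuous_measurable_rV.
  exact: (smooth_continuous (@smooth_cutoff R n _)).
have ig k : mu.-integrable setT (EFin \o g k).
  apply: (integrable_mul_bounded (M := 1) intf).
    apply: continuous_measurable_rV.
    exact: (smooth_continuous (@smooth_cutoff R n _)).
  by move=> x; rewrite ger0_norm ?cutoff_ge0 ?cutoff_le1.
have /choice[F hF] k : exists F : 'rV[R]_n -> R, [/\ test_function F,
    (\int[mu]_x (`|F x - g k x|)%:E <= (s_ k)%:E)%E
    & (frac_variation alpha F <= frac_variation alpha (g k))%E].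
  (* The mollification scale d depends on k through the translation modulus of [g k]. *)
  have [d d0 hd] := L1_translation_modulus (ig k) (s0 k).
  have [rho [trho rho0 rhod rho1]] := @mollifier_exists R n _ d0.
  exists (mollify rho (g k)); split.
  - apply: (test_function_mollify (ig k) (a := (s_ k)^-1) (b := d)) => // y sy.
    suff -> : g k y = f y * 0 by rewrite mulr0.
    congr (_ * _); apply/eqP; apply: contraTT sy => /(cutoff_neq0 (s0 k)).
    by rewrite -leNgt.
  - exact: (mollify_L1_le (ig k) trho rho0 rhod rho1 hd).
  - exact: frac_variation_mollify_le.
have mF k : measurable_fun setT (F k).
  by apply: continuous_measurable_rV; apply: test_function_continuous; case: (hF k).
have iF k : mu.-integrable setT (EFin \o F k).
  apply: (integrable_L1_diff (ig k) (mF k)).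
  by have [_ h _] := hF k; exact: (le_lt_trans h (ltry _)).
have FL1 : (\int[mu]_x (`|F k x - f x|)%:E)%E @[k --> \oo] --> 0%E.
  apply: (@squeeze_cvge _ _ _ _ (cst 0%E) _
    (fun k => (s_ k)%:E + \int[mu]_x (`|g k x - f x|)%:E)%E).
  - apply: nearW => k; rewrite integral_ge0//=.
    have [_ h _] := hF k; apply: (@le_trans _ _
      (\int[mu]_x ((`|F k x - g k x|)%:E + (`|g k x - f x|)%:E))%E).
      apply: ge0_le_integral => //.
      + by apply/measurable_EFinP; apply: measurableT_comp => //; exact: measurable_funB.
      + by apply: emeasurable_funD; apply/measurable_EFinP;
          apply: measurableT_comp => //; exact: measurable_funB.
      by move=> x _; rewrite -EFinD lee_fin -[X in `|X|](subrKA (g k x)) ler_normD.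
    rewrite ge0_integralD//; last 2 first.
    + by apply/measurable_EFinP; apply: measurableT_comp => //; exact: measurable_funB.
    + by apply/measurable_EFinP; apply: measurableT_comp => //; exact: measurable_funB.
    exact: leeD.
  - exact: cvg_cst.
  - rewrite -[X in _ --> X]adde0; apply: cvgeD => //; first exact: cvge_harmonic.
    exact: cvg_L1_cutoff.
exists F; split => [k||]; first by case: (hF k).
  by under eq_fun do rewrite Lnorm1.
rewrite -(fineK Vfin); apply: cvge_near => e e0.
have e2 : 0 < e / 2 by rewrite divr_gt0.
have F0 k : (0 <= \int[mu]_x (`|F k x - f x|)%:E)%E by exact: integral_ge0.
have lower : \forall k \near \oo,
    ((fine (frac_variation alpha f) - e)%:E <= frac_variation alpha (F k))%E.
  (* Lower semicontinuity through a single field: some phi comes within e/2 of the finite supremum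
     for f and is then kept fixed. *)
  have : ((fine (frac_variation alpha f) - e / 2)%:E < frac_variation alpha f)%E.
    by rewrite -[X in (_ < X)%E](fineK Vfin) lte_fin ltrBlDr ltrDl.
  move=> /ereal_sup_gt[_ [phi uphi <-]]; have [tphi _] := uphi.
  rewrite (frac_pairingE alpha01 intf tphi) lte_fin => lt_phi.
  have [B hB] := frac_div_bounded alpha01 tphi.
  have B1 : 0 < `|B| + 1 by rewrite ltr_wpDl.
  (* With this L^1 error, replacing f by [F k] changes the pairing with phi by at most e/2; |B| + 1
     is a positive divisor. *)
  have := near_le_cvge0 F0 FL1 (divr_gt0 e2 B1).
  apply: filterS => k hk; apply: le_trans (frac_pairing_le alpha01 (iF k) uphi).
  rewrite lee_fin.
  have iFf : mu.-integrable setT (EFin \o (fun x => F k x - f x)).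
    have := integrableB measurableT (iF k) intf.
    by apply: eq_integrable => // x _.
  have := Rintegral_mul_bounded_le iFf (measurable_frac_div alpha tphi) hB.
  have -> : \int[mu]_x ((F k x - f x) * frac_div alpha phi x) =
      \int[mu]_x (F k x * frac_div alpha phi x) - \int[mu]_x (f x * frac_div alpha phi x).
    rewrite -RintegralB//; try exact: integrable_frac_pairing.
    by apply: eq_Rintegral => x _; rewrite mulrBl.
  have hI : \int[mu]_x `|F k x - f x| <= e / 2 / (`|B| + 1).
    rewrite -lee_fin /Rintegral fineK//.
    exact: (integrable_fin_num measurableT (integrable_norm iFf)).
  have I0 : 0 <= \int[mu]_x `|F k x - f x| by exact: Rintegral_ge0.
  have : B * \int[mu]_x `|F k x - f x| <= e / 2.
    apply: (@le_trans _ _ ((`|B| + 1) * \int[mu]_x `|F k x - f x|)).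
      by rewrite ler_wpM2r// (le_trans (ler_norm B))// lerDl.
    by rewrite -ler_pdivlMl// mulrC.
  rewrite ler_norml => h1 /andP[h2 _]; lra.
have upper : \forall k \near \oo,
    (frac_variation alpha (F k) <= (fine (frac_variation alpha f) + e)%:E)%E.
  (* The excess allowed by [frac_variation_cutoff_le] is K times the kernel integral; K + 1 is used
     as divisor because K may vanish. *)
  pose K := `|mu_const n alpha| * n%:R * \int[mu]_x `|f x|.
  have K0 : 0 <= K by rewrite !mulr_ge0//; apply: Rintegral_ge0.
  have K1 : 0 < K + 1 by rewrite ltr_wpDl.
  have ker0 k : (0 <= \int[mu]_h (frac_kernel alpha (L / k.+1%:R) h)%:E)%E.
    by apply: integral_ge0 => h _; rewrite lee_fin frac_kernel_ge0// divr_ge0.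
  have := near_le_cvge0 ker0 (cvg_integral_frac_kernel alpha01 L0) (divr_gt0 e0 K1).
  apply: filterS => k hk; have [_ _ VF] := hF k; apply: (le_trans VF).
  have Lk (x y : 'rV[R]_n) : `|cutoff (s_ k) x - cutoff (s_ k) y| <= L * s_ k * `|x - y|.
    by apply: hL; exact: ltW.
  apply: (le_trans (frac_variation_cutoff_le alpha01 (ltW (s0 k)) L0 Lk intf)).
  rewrite -[X in (X + _)%E](fineK Vfin) -EFinD lee_fin lerD2l.
  set I := \int[mu]_h _.
  have hI : I <= e / (K + 1).
    rewrite -lee_fin /I /Rintegral fineK//.
    apply: integrable_fin_num => //; apply: integrable_frac_kernel => //.
    by rewrite divr_ge0.
  have I0 : 0 <= I.
    by apply: Rintegral_ge0 => h _; rewrite frac_kernel_ge0// divr_ge0.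
  rewrite (_ : _ * _ = K * I); last by rewrite /K; ring.
  apply: (@le_trans _ _ ((K + 1) * I)); first by rewrite ler_wpM2r// lerDl.
  by rewrite -ler_pdivlMl// mulrC.
apply: filterS2 lower upper => k h1 h2; by split.
Qed.
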